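(* Let $K$ be a number field and $A$ its ring of integers, and assume $A$ is finitely coverable. Then: 1) $\sigma(A)=\inf_I \sigma(A/I)$, where $I$ ranges over the faulty ideals of $A$. 2) Let $\mathfrak{P}$ be the set of prime numbers $p$ such that (i) $p$ is a common index divisor of $K$, or (ii) there are at least $p$ prime ideals of $A$ lying over $p\mathbb{Z}$ with residual degree $1$. For $p\in\mathfrak{P}$, let $\mathfrak{F}(p)$ be the set of residual degrees $f$ of prime ideals of $A$ lying over $p\mathbb{Z}$ such that $N_p(f)<\lambda_p(f)$ if $f\ge 2$, and $p=N_p(1)\le\lambda_p(1)$ if $f=1$. Then $$\sigma(A)=\inf_{p\in\mathfrak{P}}\Big(\inf_{f\in\mathfrak{F}(p)}\sigma\big(A/\mathcal{P}_1\times\cdots\times A/\mathcal{P}_{\tau_p(f)}\big)\Big),$$ where, for each $p$ and $f$, $\mathcal{P}_1,\dots,\mathcal{P}_{\tau_p(f)}$ is any set of $\tau_p(f)$ distinct prime ideals of $A$ lying over $p\mathbb{Z}$ with residual degree $f$. 3) $\sigma(A)=\inf_{p\in\mathfrak{P}}\sigma(A/pA)$.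
   Context: Convention: rings are commutative; a subring of $R$ is an additive subgroup closed under multiplication, not necessarily containing $1$; proper means different from $R$. $R$ is coverable if it is the union of its proper subrings, finitely coverable if it is a union of finitely many proper subrings. $\sigma(R)$ is the minimal number of proper subrings whose union is $R$ if $R$ is finitely coverable; $\sigma(R)=\infty$ if $R$ is coverable but not finitely coverable; $\sigma(R)=\hat\infty$ if $R$ is not coverable, where $m<\infty<\hat\infty$ for every integer $m$. For $\theta\in A$ with $\mathbb{Q}(\theta)=K$, $I(\theta)=[A:\mathbb{Z}[\theta]]$; $I(K)$ is the gcd of all such $I(\theta)$, and a prime $p\mid I(K)$ is a common index divisor. For a prime $p$ and integer $f\ge1$: $N_p(f)$ is the number of monic irreducible polynomials of degree $f$ over $\mathbb{F}_p$; $\lambda_p(f)$ is the number of prime ideals of $A$ over $p\mathbb{Z}$ with residual degree $f$; $\tau_p(f)=p$ if $f=1$ and $\tau_p(f)=N_p(f)+1$ if $f\ge2$. A nonzero ideal $I$ of $A$ is faulty if there exist a prime $p$ and an integer $f\ge1$ with $\tau_p(f)\le I_p(f)$, where $I_p(f)$ is the number of prime ideals of $A$ lying over $p\mathbb{Z}$, dividing $I$, and of residual degree $f$. *)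

(* Defs.v *)
From HB Require Import structures.
From mathcomp Require Import all_boot all_order all_algebra all_field.
From mathcomp Require Import finmap.
From mathcomp Require Import boolp classical_sets functions cardinality.

Set Implicit Arguments.
Unset Strict Implicit.
Unset Printing Implicit Defensive.

Import Order.TTheory GRing.Theory Num.Theory.

Local Open Scope classical_set_scope.
Local Open Scope ring_scope.

(* Number of elements of a finite set (0 on infinite sets, which do not occur:
   the indices that matter are those of the primitive elements). *)
Definition setcard (T : choiceType) (E : set T) : nat := #|` fset_set E|.

Variant covnum := Fin of nat | Infty | HatInfty.

Definition covnum_code (u : covnum) : option (option nat) :=
  match u with Fin n => Some (Some n) | Infty => Some None | HatInfty => None end.

Definition covnum_decode (c : option (option nat)) : covnum :=
  match c with Some (Some n) => Fin n | Some None => Infty | None => HatInfty end.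

Lemma covnum_codeK : cancel covnum_code covnum_decode.
Proof. by case. Qed.

HB.instance Definition _ := Countable.copy covnum (can_type covnum_codeK).

(* Fin m < Infty < HatInfty for every m *)
Definition le_covnum (u v : covnum) : bool :=
  match u, v with
  | Fin m, Fin n => (m <= n)%N
  | Fin _, _ | Infty, Infty | _, HatInfty => true
  | _, _ => false
  end.

Lemma le_covnum_refl : reflexive le_covnum.
Proof. by case=> //= n; exact: leqnn. Qed.

Lemma le_covnum_anti : antisymmetric le_covnum.
Proof. by case=> [m||] [n||] //= mn; congr Fin; apply/anti_leq. Qed.

Lemma le_covnum_trans : transitive le_covnum.
Proof. by case=> [n||] [m||] [p||] //=; exact: leq_trans. Qed.

Fact covnum_display : Order.disp_t.
Proof. exact: Order.Disp tt tt. Qed.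

HB.instance Definition _ := Order.Le_isPOrder.Build covnum_display covnum
  le_covnum_refl le_covnum_anti le_covnum_trans.

(* Greatest lower bound; HatInfty being the top element, it is also the
   infimum of the empty set. *)
Definition covinf (E : set covnum) : covnum := infimum HatInfty E.

Section Covering.
Variable R : comPzRingType.

(* Subrings need not contain 1. *)
Definition is_subring (S : {pred R}) : Prop :=
  GRing.zmod_closed S /\ GRing.mulr_2closed S.

Definition proper_subring (S : {pred R}) : Prop :=
  is_subring S /\ exists x, x \notin S.

Definition coverable : Prop :=
  forall x : R, exists2 S, proper_subring S & x \in S.

Definition covered_by (n : nat) : Prop :=
  exists S : 'I_n -> {pred R},
    (forall i, proper_subring (S i)) /\ (forall x, exists i, x \in S i).

Definition finitely_coverable : Prop := exists n, covered_by n.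

(* xget selects the least n such that R is covered by n proper subrings. *)
Definition sigma : covnum :=
  if `[< finitely_coverable >] then
    Fin (xget 0%N [set n | covered_by n /\ forall m, covered_by m -> (n <= m)%N])
  else if `[< coverable >] then Infty
  else HatInfty.

End Covering.

Section DirectProduct.
Variables (I : Type) (R_ : I -> comPzRingType).

Definition prod_ring : Type := forall i, R_ i.

HB.instance Definition _ := Choice.copy prod_ring (forall i, R_ i).

Implicit Types x y z : prod_ring.

Let zero : prod_ring := fun=> 0.
Let opp x : prod_ring := fun i => - x i.
Let add x y : prod_ring := fun i => x i + y i.
Let one : prod_ring := fun=> 1.
Let mul x y : prod_ring := fun i => x i * y i.

Let addA : associative add.
Proof. by move=> x y z; apply: functional_extensionality_dep => i; exact: addrA. Qed.
Let addC : commutative add.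
Proof. by move=> x y; apply: functional_extensionality_dep => i; exact: addrC. Qed.
Let add0 : left_id zero add.
Proof. by move=> x; apply: functional_extensionality_dep => i; exact: add0r. Qed.
Let addN : left_inverse zero opp add.
Proof. by move=> x; apply: functional_extensionality_dep => i; exact: addNr. Qed.
Let mulA : associative mul.
Proof. by move=> x y z; apply: functional_extensionality_dep => i; exact: mulrA. Qed.
Let mulC : commutative mul.
Proof. by move=> x y; apply: functional_extensionality_dep => i; exact: mulrC. Qed.
Let mul1 : left_id one mul.
Proof. by move=> x; apply: functional_extensionality_dep => i; exact: mul1r. Qed.
Let mulDl : left_distributive mul add.
Proof. by move=> x y z; apply: functional_extensionality_dep => i; exact: mulrDl. Qed.

HB.instance Definition _ :=
  GRing.isZmodule.Build prod_ring addA addC add0 addN.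
HB.instance Definition _ :=
  GRing.Zmodule_isComPzRing.Build prod_ring mulA mulC mul1 mulDl.

End DirectProduct.

Section RingOfIntegers.
Variable K : fieldExtType rat.

Definition int_pred : {pred K} :=
  fun x => `[< integralOver (intr : int -> K) x >].

Lemma int_pred_subring : GRing.subring_closed int_pred.
Proof.
split=> [|x y /asboolP xA /asboolP yA|x y /asboolP xA /asboolP yA].
- by apply/asboolP; exact: integral1.
- by apply/asboolP; exact: integral_sub.
- by apply/asboolP; exact: integral_mul.
Qed.

HB.instance Definition _ := GRing.isSubringClosed.Build K int_pred
  int_pred_subring.

Lemma int_pred_natM_neq1 (n : nat) (a : K) :
  (1 < n)%N -> a \in int_pred -> 1 <> n%:R * a.
Proof.
move=> n_gt1 /asboolP[q q_monic q_root] na1.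
have q_gt0 : (0 < size q)%N by rewrite size_poly_gt0 monic_neq0.
have intrI (z : int) : z%:~R = 0 :> K -> z = 0.
  move=> z0; apply/eqP; rewrite -(intr_eq0 rat) -(fmorph_eq0 (in_alg K)).
  by rewrite rmorph_int z0.
have naX d : (n%:R : K) ^+ d * a ^+ d = 1 by rewrite -exprMn -na1 expr1n.
pose m := (size q).-1; have szq : size q = m.+1 by rewrite prednK.
have szqK : size (map_poly (intr : int -> K) q) = m.+1.
  rewrite size_map_poly_id0 ?szq // (monicP q_monic) ?rmorph1 ?oner_neq0 //.
pose N : int := \sum_(i < m) q`_i * n%:R ^+ (m - i).-1.
have /intrI/eqP : (1 + n%:R * N)%:~R = 0 :> K.
  move/rootP: q_root => /(congr1 (fun z => n%:R ^+ m * z)); rewrite mulr0.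
  rewrite horner_coef szqK big_ord_recr /= coef_map /= => <-.
  have -> : q`_m = 1 by move/monicP: q_monic.
  rewrite rmorphD rmorphM rmorph_nat rmorph1 mulrDr mul1r naX addrC.
  congr (_ + _); rewrite mulr_sumr rmorph_sum mulr_sumr.
  apply: eq_bigr => i _; rewrite coef_map /= rmorphM rmorphXn rmorph_nat.
  rewrite mulrCA -exprS prednK ?subn_gt0 // [RHS]mulrCA; congr (_ * _).
  rewrite -[X in _ = _ ^+ X * _](subnK (ltnW (ltn_ord i))).
  by rewrite exprD -mulrA naX mulr1.
rewrite addrC addr_eq0 => /eqP nN1.
have : (n%:Z %| (-1)%R)%Z by rewrite -nN1 -natz dvdz_mulr.
by rewrite dvdzE /= dvdn1 => /eqP n1; rewrite n1 in n_gt1.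
Qed.

Record ring_int := RingInt { ring_int_val :> K; _ : ring_int_val \in int_pred }.

HB.instance Definition _ := [isSub for ring_int_val].
HB.instance Definition _ := [Choice of ring_int by <:].
HB.instance Definition _ := [SubChoice_isSubComNzRing of ring_int by <:].

End RingOfIntegers.

Section NumberField.
Variable K : fieldExtType rat.
Local Notation A := (ring_int K).

Definition primitive_elt (theta : A) : Prop :=
  <<1; (theta : K)>>%VS = fullv :> {vspace K}.

(* Z[theta] *)
Definition int_adjoin (theta : A) : set A :=
  [set x | exists q : {poly int}, x = (map_poly intr q).[theta]].

(* The index [A : Z[theta]], as the number of cosets of Z[theta] in A *)
Definition adjoin_index (theta : A) : nat :=
  setcard (range (fun a : A => [set a + z | z in int_adjoin theta])).

(* I(K), the gcd of the indices of the integral primitive elements *)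
Definition field_index : nat :=
  xget 0%N [set d | (forall theta, primitive_elt theta -> (d %| adjoin_index theta)%N)
    /\ forall e, (forall theta, primitive_elt theta -> (e %| adjoin_index theta)%N) ->
         (e %| d)%N].

Definition common_index_divisor (p : nat) : Prop :=
  prime p /\ (p %| field_index)%N.

(* P lies over pZ, i.e. the intersection of P and Z is pZ *)
Definition lies_over (P : prime_idealr A) (p : nat) : Prop :=
  forall n : int, (n%:~R \in P) = (p %| n)%Z.

(* The residue ring A/P has characteristic p and dimension f over 'F_p. *)
Definition residual_degree (P : prime_idealr A) (p f : nat) : Prop :=
  exists charP : p \in [pchar {ideal_quot P}],
    inhabited (Vector.axiom f (pPrimeCharType charP)).

Definition prime_over (p f : nat) (P : prime_idealr A) : Prop :=
  lies_over P p /\ residual_degree P p f.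

(* Ideals here may be all of A, unlike those of type idealr A. *)
Definition is_ideal (J : {pred A}) : Prop :=
  GRing.zmod_closed J /\ forall a, {in J, forall u, a * u \in J}.

Definition ideal_mul (I J : {pred A}) : set A :=
  [set x | exists n (a b : 'I_n -> A),
     (forall k, a k \in I /\ b k \in J) /\ x = \sum_(k < n) a k * b k].

Definition ideal_divides (I J : {pred A}) : Prop :=
  exists2 L : {pred A}, is_ideal L & [set` J] = ideal_mul I L.

(* N_p(f) *)
Definition nb_irr (p f : nat) : nat :=
  setcard [set q : {poly 'F_p} |
    [/\ q \is monic, irreducible_poly q & size q = f.+1]].

(* lambda_p(f); ideals are counted as subsets of A *)
Definition nb_primes (p f : nat) : nat :=
  setcard [set X : set A | exists P : prime_idealr A,
    X = [set` P] /\ prime_over p f P].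

(* I_p(f) *)
Definition nb_prime_divisors (I : idealr A) (p f : nat) : nat :=
  setcard [set X : set A | exists P : prime_idealr A,
    [/\ X = [set` P], prime_over p f P & ideal_divides P I]].

Definition tau (p f : nat) : nat := if f == 1%N then p else (nb_irr p f).+1.

(* The elements of type idealr A are the proper ideals of A; no ideal is lost
   since A itself has no prime divisor, whereas tau p f > 0. *)
Definition faulty (I : idealr A) : Prop :=
  (exists2 x : A, x \in I & x != 0) /\
  exists p f : nat,
    [/\ prime p, (1 <= f)%N & (tau p f <= nb_prime_divisors I p f)%N].

Definition frakP : set nat :=
  [set p | prime p /\ (common_index_divisor p \/ (p <= nb_primes p 1)%N)].

Definition frakF (p : nat) : set nat :=
  [set f | (exists P, prime_over p f P) /\
    if f == 1%N then (p <= nb_primes p 1)%N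
    else (nb_irr p f < nb_primes p f)%N].

Section PrincipalIdeal.
Variables (p : nat) (p_prime : prime p).

(* pA; the primality of p, which guarantees that pA is proper, is an argument
   so that it can serve to infer the ideal structure. *)
Definition pA_pred of prime p : {pred A} :=
  fun x => `[< exists a : A, x = p%:R * a >].

Lemma pA_idealr_closed : idealr_closed (pA_pred p_prime).
Proof.
split.
- by apply/asboolP; exists 0; rewrite mulr0.
- apply/asboolP => -[a] /(congr1 val); rewrite rmorphM rmorph_nat rmorph1.
  by apply: int_pred_natM_neq1; [rewrite prime_gt1 | exact: valP].
- move=> a x y /asboolP[b ->] /asboolP[c ->]; apply/asboolP.
  by exists (a * b + c); rewrite mulrDr mulrCA.
Qed.

HB.instance Definition _ := isIdealr.Build A (pA_pred p_prime) pA_idealr_closed.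

Definition pA : idealr A := pA_pred p_prime.

End PrincipalIdeal.

End NumberField.

(* Main.v *)
(* By Neumann's lemma the members of finite index of a finite cover of A by proper subrings already
   cover A. Each of them, enlarged by some pA, stays proper, and by the Chinese remainder theorem
   the enlarged subrings attached to a single p cover A. A proper subring S containing pA either
   misses a residue class of some prime P over p, or two primes P, Q over p have isomorphic residue
   fields and S maps to the graph of an isomorphism in A/P x A/Q, or S is of ramified type and can be
   avoided by a generic lift. Sorting by residual degree, one f is left for which the subrings of the
   first two types over primes of degree f cover A, that is, cover a power k^V of k = F_(p^f).

   For such covers let N = tau p f - 1 be the number of Frobenius orbits of elements of k lying in no
   maximal proper subring, and w <= f the number of these subrings. In a minimal set T of
   coordinates that still supports a cover, every coordinate is met by at least f N graphs, and by at
   least f N + w subrings. Double counting yields at least (N+1)(fN/2 + w) subrings and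
   #|T| >= N+1. Conversely, that many subrings cover k^(N+1), so every quotient of A that maps onto
   A/P_1 x ... x A/P_tau has the same covering number as A. *)
Require Import Defs.
From HB Require Import structures.
From mathcomp Require Import finmap.
From mathcomp Require Import boolp classical_sets cardinality.
From mathcomp Require Import all_boot all_order all_fingroup all_algebra all_solvable all_field.
From mathcomp Require Import zify ring.

Set Implicit Arguments.
Unset Strict Implicit.
Unset Printing Implicit Defensive.

Import Order.TTheory GRing.Theory Num.Theory.
Local Open Scope ring_scope.
Local Open Scope quotient_scope.

(** * Subrings and Frobenius orbits of finite fields *)

(** A vector whose entries generate k and have pairwise distinct minimal polynomials escapes all
    subrings of the first two types, and only N such polynomials exist. On N + 1 coordinates the w
    maximal subrings at each coordinate and the f Frobenius graphs for each of the N(N+1)/2 pairs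
    therefore cover, which explains the constant. The lower bound is harder because a cover may
    spread over more coordinates, each then with a weaker guarantee; minimality of T controls this
    trade-off. Sorting by degree is possible because linked primes have equal residual degree, so
    that elements bad for the single degrees can be glued by the Chinese remainder theorem. A/pA
    need not be reduced: gluing residues leaves the freedom of a lift, and this freedom defeats the
    ramified subrings. The arithmetic of A enters through the finiteness of A/mA, the absence of
    torsion and integral closedness; most existence arguments are pigeonhole in A/pA. *)

Section FiniteFieldSubrings.
Variable k : finFieldType.
Implicit Types (M : {set k}) (x y : k).

Definition subr M : bool :=
  [&& 0 \in M, [forall x in M, forall y in M, x - y \in M]
    & [forall x in M, forall y in M, x * y \in M]].

Lemma subrP M : reflect [/\ 0 \in M, {in M &, forall x y, x - y \in M}
    & {in M &, forall x y, x * y \in M}] (subr M).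
Proof.
apply: (iffP and3P) => [[M0 /forall_inP MB /forall_inP MM]|[M0 MB MM]]; split=> //.
- by move=> x y xM yM; have /forall_inP := MB x xM; apply.
- by move=> x y xM yM; have /forall_inP := MM x xM; apply.
- by apply/forall_inP => x xM; apply/forall_inP => y yM; exact: MB.
- by apply/forall_inP => x xM; apply/forall_inP => y yM; exact: MM.
Qed.

Lemma subrT : subr setT.
Proof. by apply/subrP; split=> [|x y _ _|x y _ _]; rewrite inE. Qed.

Lemma subr_set0 : subr [set 0].
Proof.
by apply/subrP; split=> [|x y /set1P-> /set1P->|x y /set1P-> /set1P->];
   rewrite ?inE ?subrr ?mulr0.
Qed.

Lemma set0_neqT : [set 0] != [set: k].
Proof. by apply/eqP => /setP/(_ 1); rewrite !inE oner_eq0. Qed.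

Lemma subr_exp M x n : subr M -> x \in M -> x ^+ n.+1 \in M.
Proof.
move=> /subrP[_ _ MM] xM; elim: n => [|n IH]; rewrite ?expr1 //.
by rewrite exprS MM.
Qed.

Lemma expf_card_pred x : x != 0 -> x ^+ (#|k|.-1) = 1.
Proof.
move=> x0; apply: (mulfI x0); rewrite mulr1 -exprS prednK ?expf_card //.
exact: ltn_trans (finNzRing_gt1 k).
Qed.

Lemma subr1 M x : subr M -> x \in M -> x != 0 -> 1 \in M.
Proof.
move=> sM xM x0; rewrite -(expf_card_pred x0).
have : (0 < #|k|.-1)%N by rewrite -ltnS prednK ?finNzRing_gt1 ?(ltn_trans _ (finNzRing_gt1 k)).
by case: (#|k|.-1) => // n _; apply: subr_exp.
Qed.

Lemma subr_add M x y : subr M -> x \in M -> y \in M -> x + y \in M.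
Proof.
by move=> /subrP[M0 MB _] xM yM; rewrite -[y]opprK -[- y]add0r !MB.
Qed.

Lemma subr_nat M n : subr M -> 1 \in M -> n%:R \in M.
Proof.
move=> sM M1; have /subrP[M0 _ _] := sM; elim: n => // n IH.
by rewrite -natr1; apply: subr_add.
Qed.

(** Multiplication by [x] permutes the nonzero elements of [M], so it leaves their product
    unchanged. *)
Lemma subr_card_pred M x : subr M -> x \in M -> x != 0 -> x ^+ (#|M|.-1) = 1.
Proof.
move=> /subrP[M0 MB MM] xM x0; set M' := M :\ 0.
have MM' : [set x * m | m in M'] = M'.
  apply/eqP; rewrite eqEcard card_imset ?leqnn ?andbT; last exact: mulfI.
  apply/subsetP => _ /imsetP[m /setD1P[m0 mM] ->].
  by rewrite !inE mulf_neq0 //= MM.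
have prod0 : \prod_(m in M') m != 0.
  by apply/prodf_neq0 => m /setD1P[].
apply: (mulIf prod0); rewrite mul1r (_ : #|M|.-1 = #|M'|); last first.
  by rewrite (cardsD1 0 M) M0.
rewrite -[in RHS]MM' big_imset /=; last by move=> a b _ _; exact: mulfI.
by rewrite big_split /= prodr_const.
Qed.

(** The elements of [M] are roots of ['X^#|M| - 'X] and exhaust them by degree, so a subring is
    determined by its cardinality. For the zero ring this polynomial vanishes, hence the bound on
    [#|M|]. *)
Lemma subr_memE M x : subr M -> (1 < #|M|)%N -> (x \in M) = (x ^+ #|M| == x).
Proof.
move=> sM cM; have cM0 : (0 < #|M|)%N := ltnW cM.
have fixM y : y \in M -> y ^+ #|M| = y.
  move=> yM; have [->|y0] := eqVneq y 0; first by rewrite expr0n gtn_eqF.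
  by rewrite -[in LHS](prednK cM0) exprS (subr_card_pred sM) ?mulr1.
apply/idP/eqP => [/fixM//|xfix]; apply: contraTT (leqnn #|M|) => xM.
pose q : {poly k} := 'X^#|M| - 'X.
have szq : size q = #|M|.+1.
  by rewrite size_polyDl size_polyXn // size_polyN size_polyX ltnS.
have q0 : q != 0 by rewrite -size_poly_eq0 szq.
have := @max_poly_roots _ q (x :: enum M) q0.
rewrite szq /= -cardE ltnS => H; rewrite -ltnNge; apply: H.
  rewrite /root !hornerE xfix subrr eqxx /=; apply/allP => y.
  by rewrite mem_enum => /fixM yfix; rewrite /root !hornerE yfix subrr.
by rewrite mem_enum xM enum_uniq.
Qed.

Lemma subr_card_inj M M' : subr M -> subr M' -> #|M| = #|M'| -> M = M'.
Proof.
move=> sM sM' eqc; have /subrP[M0 _ _] := sM; have /subrP[M'0 _ _] := sM'.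
have [cM|cM] := ltnP 1 #|M|; first by apply/setP => x; rewrite !subr_memE -?eqc.
have set0M (B : {set k}) : 0 \in B -> (#|B| <= 1)%N -> B = [set 0].
  by move=> B0 cB; apply/esym/eqP; rewrite eqEcard sub1set B0 cards1.
by rewrite (set0M _ M0 cM) (set0M M') // -eqc.
Qed.

(** The nonzero part of [M] is a cyclic group of roots of unity; the powers of a generator reach
    everything but 0. *)
Lemma subr_gen M : subr M ->
  exists2 g, g \in M & forall M', subr M' -> g \in M' -> M \subset M'.
Proof.
move=> sM; have /subrP[M0 _ _] := sM; have [cM|cM] := ltnP 1 #|M|; last first.
  exists 0 => // M' _ M'0; have -> : M = [set 0].
    by apply/esym/eqP; rewrite eqEcard sub1set M0 cards1.
  by rewrite sub1set.
set M1 := M :\ 0; have cM1 : #|M1| = #|M|.-1 by rewrite (cardsD1 0 M) M0.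
have n_gt0 : (0 < #|M|.-1)%N by rewrite -ltnS prednK // ltnW.
have /hasP[g] : has (#|M|.-1).-primitive_root (enum M1).
  apply: has_prim_root; rewrite ?enum_uniq -?cardE ?cM1 //.
  apply/allP => x; rewrite mem_enum => /setD1P[x0 xM].
  by rewrite unity_rootE subr_card_pred.
rewrite mem_enum => /setD1P[g0 gM] prim_g.
exists g => // M' sM' gM'; apply/subsetP => x xM; have /subrP[M'0 _ _] := sM'.
have [->//|x0] := eqVneq x 0.
have [[i _] /= ->] := prim_rootP prim_g (subr_card_pred sM xM x0).
by case: i => [|i]; [rewrite expr0 (subr1 sM' gM') | apply: subr_exp].
Qed.

Lemma card_subr_dvd M : subr M -> (#|M| %| #|k|)%N.
Proof.
move=> sM; have gM : group_set M.
  apply/group_setP; split; first by case/subrP: sM.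
  by move=> x y xM yM; apply: subr_add.
by have := cardSg (subsetT (Group gM)); rewrite cardsT.
Qed.

Definition max_subr : {set {set k}} :=
  [set M | maxset (fun B => subr B && (B != setT)) M].

Lemma max_subrP M : M \in max_subr ->
  [/\ subr M, M != setT & forall M', subr M' -> M' != setT -> M \subset M' -> M' = M].
Proof.
rewrite inE => /maxsetP[/andP[sM nM] maxM]; split=> // M' sM' nM' MM'.
by apply: maxM => //; rewrite sM'.
Qed.

Lemma sub_max_subr M : subr M -> M != setT ->
  exists2 M', M' \in max_subr & M \subset M'.
Proof.
move=> sM nM; have [|M' mM' MM'] := @maxset_exists _ (fun B => subr B && (B != setT)) M.
  by rewrite sM.
by exists M'; rewrite ?inE.
Qed.

Lemma max_subr_gen M : M \in max_subr ->
  exists2 g, g \in M & forall M', subr M' -> M' != setT -> g \in M' -> M' = M.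
Proof.
move=> /max_subrP[sM nM maxM]; have [g gM gmin] := subr_gen sM.
by exists g => // M' sM' nM' gM'; apply: maxM => //; apply: gmin.
Qed.

(** A maximal proper subring has p^j elements with j < f, and distinct ones have distinct sizes.
    This crude bound is what the count over more than N + 1 coordinates requires. *)
Lemma card_max_subr p f : prime p -> #|k| = (p ^ f)%N -> (#|max_subr| <= f)%N.
Proof.
move=> p_pr cardk; have p1 := prime_gt1 p_pr.
pose h M := logn p #|M|.
have hM M : M \in max_subr -> #|M| = (p ^ h M)%N /\ (h M < f)%N.
  move=> /max_subrP[sM nM _]; have := card_subr_dvd sM; rewrite cardk.
  case/(dvdn_pfactor _ _ p_pr) => j _ cM; rewrite /h cM pfactorK //; split=> //.
  by rewrite -(ltn_exp2l _ _ p1) -cM -cardk -cardsT proper_card // properT.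
have [f0|f_gt0] := posnP f.
  rewrite f0 leqn0 cards_eq0; apply/eqP/setP => M; rewrite in_set0.
  by apply/negP => /hM[_]; rewrite f0.
pose h' M : 'I_f := Ordinal (ltn_pmod (h M) f_gt0).
rewrite -[leqRHS]card_ord -(@card_in_imset _ _ h') ?max_card //.
move=> M M' /[dup] MW /hM[cM hf] /[dup] M'W /hM[cM' hf'] /(congr1 val) /=.
rewrite !modn_small // => hh; apply: subr_card_inj; last by rewrite cM cM' hh.
  by case/max_subrP: MW.
by case/max_subrP: M'W.
Qed.

(** The ring generators of [k]: the nonzero elements when [k] is a prime field, the elements of full
    degree over the prime field otherwise. *)
Definition gens : {set k} := [set x | [forall M, subr M ==> (x \in M) ==> (M == setT)]].

Lemma gensP x : reflect (forall M, subr M -> x \in M -> M = setT) (x \in gens).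
Proof.
rewrite inE; apply: (iffP forallP) => [H M sM xM|H M].
  by have := H M; rewrite sM xM => /eqP.
by apply/implyP => sM; apply/implyP => xM; rewrite (H M).
Qed.

Lemma gens_neq0 x : x \in gens -> x != 0.
Proof.
move=> /gensP gx; apply/eqP => x0; have := set0_neqT; rewrite (gx [set 0]) ?eqxx //.
  exact: subr_set0.
by rewrite x0 set11.
Qed.

Lemma notin_gens x : x \notin gens -> exists2 M, M \in max_subr & x \in M.
Proof.
rewrite inE negb_forall => /existsP[M]; rewrite !negb_imply => /and3P[sM xM nM].
by have [M' M'W MM'] := sub_max_subr sM nM; exists M' => //; exact: (subsetP MM').
Qed.

Lemma gens_max_subr x M : x \in gens -> M \in max_subr -> x \notin M.
Proof.
by move=> /gensP gx /max_subrP[sM nM _]; apply: contra nM => /(gx _ sM)->.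
Qed.

End FiniteFieldSubrings.

(** * Generators of a finite field and their minimal polynomials *)

Section FrobeniusClasses.
Variables (p f : nat) (k : finFieldType).
Hypothesis charp : p \in [pchar k].
Hypothesis cardk : #|k| = (p ^ f)%N.
Hypothesis f_gt0 : (0 < f)%N.
Local Notation L := (pPrimeCharType charp).

Lemma Fp_embed : {rmorphism 'F_p -> k}.
Proof. exact: (GRing.in_alg L : {rmorphism 'F_p -> L}). Qed.
Local Notation iota := Fp_embed.

Let p_pr : prime p := pcharf_prime charp.
Let p_gt1 : (1 < p)%N := prime_gt1 p_pr.

Lemma Fp_embedE a : iota a = (val a)%:R.
Proof. by rewrite -[in LHS](natr_Zp a) (rmorph_nat iota). Qed.

Lemma map_in_alg (q : {poly 'F_p}) : map_poly (GRing.in_alg L) q = map_poly iota q.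
Proof.
apply: eq_map_poly => a; rewrite Fp_embedE -[in LHS](natr_Zp a).
exact: (rmorph_nat (GRing.in_alg L : {rmorphism 'F_p -> L})).
Qed.

Lemma subr_Fp (M : {set k}) a : subr M -> 1 \in M -> iota a \in M.
Proof. by move=> sM M1; rewrite Fp_embedE subr_nat. Qed.

Lemma subr_horner (M : {set k}) x (q : {poly 'F_p}) :
  subr M -> 1 \in M -> x \in M -> (map_poly iota q).[x] \in M.
Proof.
move=> sM M1 xM; have /subrP[M0 _ MM] := sM; elim/poly_ind: q => [|q c IH].
  by rewrite rmorph0 horner0.
rewrite rmorphD rmorphM /= map_polyX map_polyC hornerMXaddC.
by apply: subr_add; [|apply: MM|apply: subr_Fp].
Qed.

Lemma expr_pow_inj j : injective (fun x : k => x ^+ (p ^ j)).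
Proof.
elim: j => [|j IH] x y; first by rewrite !expr1.
rewrite /= !expnSr !exprM -!(pFrobenius_autE charp) => /fmorph_inj.
exact: IH.
Qed.

Lemma exprB_pow (x y : k) j : (x - y) ^+ (p ^ j) = x ^+ (p ^ j) - y ^+ (p ^ j).
Proof.
elim: j => [|j IH]; first by rewrite !expr1.
by rewrite !expnSr !exprM IH -!(pFrobenius_autE charp) rmorphB.
Qed.

Lemma subr_expfix j : subr [set x : k | x ^+ (p ^ j) == x].
Proof.
apply/subrP; split=> [|x y|x y]; rewrite !inE.
- by rewrite expr0n expn_eq0 gtn_eqF // ltnW.
- by rewrite exprB_pow => /eqP-> /eqP->.
- by rewrite exprMn => /eqP-> /eqP->.
Qed.

Lemma rmorph_horner_Frobenius (q : {poly 'F_p}) x j :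
  root (map_poly iota q) x -> root (map_poly iota q) (x ^+ (p ^ j)).
Proof.
move=> qx; elim: j => [|j]; first by rewrite expr1.
rewrite expnSr exprM; move: (x ^+ _) => y /rootP qy.
pose F : {rmorphism k -> k} := pFrobenius_aut charp.
rewrite -(pFrobenius_autE charp) -[pFrobenius_aut _ y]/(F y); apply/rootP.
have -> : map_poly iota q = map_poly F (map_poly iota q).
  rewrite -map_poly_comp; apply: eq_map_poly => a.
  by rewrite /comp Fp_embedE [RHS](rmorph_nat F).
by rewrite horner_map qy rmorph0.
Qed.

(* The minimal polynomials of the elements of gens k. For f = 1 the maximal proper subring of
   'F_p is 0, so 'X must be left out; in all cases there are tau p f - 1 of them. *)
Definition conj_poly (q : {poly 'F_p}) : Prop :=
  [/\ q \is monic, irreducible_poly q, size q = f.+1 & q != 'X].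

Lemma common_root_dvdp (q q' : {poly 'F_p}) x : irreducible_poly q ->
  root (map_poly iota q) x -> root (map_poly iota q') x -> q %| q'.
Proof.
move=> irr_q qx q'x; apply: contraTT q'x => ndvd.
have : coprimep (map_poly iota q) (map_poly iota q').
  by rewrite coprimep_map irreducible_poly_coprime.
by move=> /coprimep_root/(_ qx); rewrite rootE.
Qed.

Lemma conj_poly_inj q q' x : conj_poly q -> conj_poly q' ->
  root (map_poly iota q) x -> root (map_poly iota q') x -> q = q'.
Proof.
move=> [mq iq _ _] [mq' iq' _ _] qx q'x; apply/eqP; rewrite -eqp_monic //.
by rewrite /eqp !(common_root_dvdp _ qx, common_root_dvdp _ q'x).
Qed.

(** [q] has a root in the extension of degree f that it defines, whose elements all satisfy X^(p^f)
    = X. Hence [q] divides X^(p^f) - X, which splits over [k]. *)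
Lemma conj_poly_root q : conj_poly q -> exists x, root (map_poly iota q) x.
Proof.
move=> [_ irr_q szq _]; have q_gt1 := irr_q.1.
have [K dimK [z qz _]] := irredp_FAdjoin irr_q.
pose FK := FinFieldExtType K.
have cardK : #|FK| = (p ^ f)%N.
  by rewrite -(@card_vspacef _ FK (Vector.class K)) card_vspace dimK szq card_Fp.
have dvdq : q %| 'X^(p ^ f) - 'X.
  apply: contraTT qz => ndvd.
  have : coprimep (map_poly (GRing.in_alg K) q) (map_poly (GRing.in_alg K) ('X^(p ^ f) - 'X)).
    by rewrite coprimep_map irreducible_poly_coprime.
  rewrite coprimep_sym => /coprimep_root H; apply: H.
  rewrite rmorphB /= map_polyXn map_polyX rootE !hornerE.
  by rewrite -cardK [_ ^+ _](expf_card (z : FK)) subrr.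
have : map_poly iota q %| \prod_x ('X - x%:P).
  rewrite -finField_genPoly cardk -(map_polyXn iota) -(map_polyX iota) -rmorphB.
  by rewrite dvdp_map.
move=> /dvdp_prod_XsubC[m eqm].
have [s0|] := posnP (size (mask m (index_enum k))).
  have := eqp_size eqm; rewrite (size0nil s0) big_nil size_polyC oner_eq0 size_map_poly.
  by move=> sz1; rewrite sz1 in q_gt1.
case ms: (mask _ _) => [//|x s] _; exists x.
by rewrite (eqp_root eqm) ms root_prod_XsubC mem_head.
Qed.

(** The algebra generated by [x] over the prime field is a subring containing [x], hence all of [k],
    so the minimal polynomial has degree f. It differs from ['X] because a generator is nonzero. *)
Lemma gens_root x : x \in gens k -> exists2 q, conj_poly q & root (map_poly iota q) x.
Proof.
move=> xg; have x0 := gens_neq0 xg; have /gensP gx := xg.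
have dimk : \dim {: L : vectType 'F_p} = f.
  by rewrite pprimeChar_dimf cardk pfactorK.
have full : <<1; (x : L)>>%VS = fullv.
  pose M : {set k} := [set y | (y : L) \in <<1; (x : L)>>%VS].
  have sM : subr M.
    apply/subrP; split=> [|y z|y z]; rewrite !inE ?mem0v //.
      by move=> *; rewrite rpredB.
    by move=> *; rewrite rpredM.
  have xM : x \in M by rewrite inE memv_adjoin.
  apply/vspaceP => y; have := in_setT (y : k); rewrite -(gx M sM xM) inE => ->.
  by rewrite memvf.
have degx : adjoin_degree 1 (x : L) = f.
  by have := dim_Fadjoin 1 (x : L); rewrite full dimk dimv1 muln1.
have /polyOver1P[q qE] := minPolyOver 1 (x : L).
have szq : size q = f.+1 by have := size_minPoly 1%AS (x : L); rewrite qE size_map_poly degx.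
have qx : root (map_poly iota q) x by have := root_minPoly 1%AS (x : L); rewrite qE map_in_alg.
exists q => //; split=> //.
- by have := monic_minPoly 1%AS (x : L); rewrite qE map_monic.
- split; first by rewrite szq ltnS.
  move=> d szd dq.
  have dm : map_poly (GRing.in_alg L) d %| minPoly 1%AS (x : L) by rewrite qE dvdp_map.
  have /orP[] := @minPoly_irr _ L 1%AS (x : L) _ (alg_polyOver 1%AS d) dm.
    by rewrite qE eqp_map.
  rewrite map_in_alg -(rmorph1 (map_poly iota)) eqp_map => /eqp_size; rewrite size_poly1 => sd.
  by rewrite sd in szd.
- apply: contraNneq x0 => qX; move: qx; rewrite qX map_polyX rootE hornerX //.
Qed.

(** Being nonzero, [x] brings 1 and then all of F_p[x] into any subring containing it; this algebra
    is [k] by degree. *)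
Lemma conj_poly_gens q x : conj_poly q -> root (map_poly iota q) x -> x \in gens k.
Proof.
move=> [mq irr_q szq qX] qx; apply/gensP => M sM xM.
have x0 : x != 0.
  apply: contraNneq qX => x0; rewrite -eqp_monic ?monicX //.
  rewrite eqp_sym; apply: irr_q.2; first by rewrite size_polyX.
  apply: (@common_root_dvdp _ _ 0); last by rewrite -x0.
    by have := irredp_XsubC (0 : 'F_p); rewrite subr0.
  by rewrite map_polyX rootE hornerX.
have M1 := subr1 sM xM x0.
have dimk : \dim {: L : vectType 'F_p} = f.
  by rewrite pprimeChar_dimf cardk pfactorK.
have full : <<1; (x : L)>>%VS = fullv.
  apply/eqP; rewrite eqEdim subvf dimk dim_Fadjoin dimv1 muln1.
  have /polyOver1P[m mE] := minPolyOver 1 (x : L).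
  have mx : root (map_poly iota m) x by have := root_minPoly 1%AS (x : L); rewrite mE map_in_alg.
  have := size_minPoly 1%AS (x : L); rewrite mE size_map_poly => szm.
  rewrite -ltnS -szm -szq dvdp_leq ?(common_root_dvdp irr_q qx) //.
  by have := monic_minPoly 1%AS (x : L); rewrite mE map_monic => /monic_neq0.
apply/setP => y; rewrite inE.
have /Fadjoin_polyP[_ /polyOver1P[r ->] ->] : (y : L) \in <<1; (x : L)>>%VS.
  by rewrite full memvf.
rewrite map_in_alg.
exact: subr_horner.
Qed.

(** Otherwise some d-th power of Frobenius with 0 < d < f fixes [x], hence all of [k], and X^(p^d) -
    X has p^f roots. *)
Lemma gens_expr_inj x i j : x \in gens k -> (i < f)%N -> (j < f)%N ->
  x ^+ (p ^ i) = x ^+ (p ^ j) -> i = j.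
Proof.
move=> /gensP gx; wlog ij : i j / (i <= j)%N => [W|] if_ jf.
  by case: (leqP i j) => [|/ltnW] ij; [|move=> /esym]; move/(W _ _ ij) => -> //.
rewrite -(subnKC ij) expnD mulnC exprM => /expr_pow_inj fix_x.
have [->|d0] := posnP (j - i); first by rewrite addn0.
have df : (j - i < f)%N by rewrite (leq_ltn_trans (leq_subr _ _)).
have := gx _ (subr_expfix (j - i)); rewrite inE -fix_x eqxx => /(_ isT) /setP full.
pose r : {poly k} := 'X^(p ^ (j - i)) - 'X.
have szr : size r = (p ^ (j - i)).+1.
  rewrite size_polyDl size_polyXn // size_polyN size_polyX ltnS.
  by apply: (@leq_ltn_trans (p ^ 0)); rewrite ?expn0 // -[1%N](expn0 p) ltn_exp2l.
have r0 : r != 0 by rewrite -size_poly_eq0 szr.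
have := @max_poly_roots _ r (enum k) r0.
rewrite szr enum_uniq -cardE cardk ltnS leq_exp2l // => H.
suff : (f <= j - i)%N by rewrite leqNgt df.
apply: H => //; apply/allP => y _; rewrite /root !hornerE subr_eq0.
by have := full y; rewrite !inE.
Qed.

Lemma conj_poly_roots q x y : conj_poly q ->
  root (map_poly iota q) x -> root (map_poly iota q) y ->
  exists j : 'I_f, y = x ^+ (p ^ j).
Proof.
move=> cq qx qy; have xg := conj_poly_gens cq qx.
suff /existsP[j /eqP yE] : [exists j : 'I_f, y == x ^+ (p ^ j)] by exists j.
apply: contraT => /existsPn H.
have [mq _ szq _] := cq.
(* [y] together with the f distinct conjugates of [x] would be f + 1 roots of a polynomial of degree
   f. *)
pose rs := y :: [seq x ^+ (p ^ (j : 'I_f)) | j <- enum 'I_f].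
have := @max_poly_roots _ (map_poly iota q) rs.
rewrite size_map_poly szq [size rs]/= size_map -cardE card_ord ltnn; apply.
- by rewrite monic_neq0 // map_monic.
- apply/andP; split=> //; apply/allP => _ /mapP[j _ ->]; exact: rmorph_horner_Frobenius.
rewrite /rs cons_uniq map_inj_uniq ?enum_uniq ?andbT.
  by apply/mapP => -[j _ yE]; move: (H j); rewrite yE eqxx.
by move=> i j /(gens_expr_inj xg (ltn_ord i) (ltn_ord j)) /val_inj.
Qed.

Lemma card_conj_roots q : conj_poly q ->
  (f <= #|[set x : k | root (map_poly iota q) x]|)%N.
Proof.
move=> cq; have [x qx] := conj_poly_root cq; have xg := conj_poly_gens cq qx.
pose h (j : 'I_f) := x ^+ (p ^ j).
have h_inj : injective h.
  by move=> i j /(gens_expr_inj xg (ltn_ord i) (ltn_ord j)) /val_inj.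
rewrite -[f in leqLHS]card_ord -(card_imset _ h_inj) subset_leq_card //.
apply/subsetP => _ /imsetP[j _ ->]; rewrite inE; exact: rmorph_horner_Frobenius.
Qed.

Lemma card_gens_ge (s : seq {poly 'F_p}) : uniq s -> (forall q, q \in s -> conj_poly q) ->
  (f * size s <= #|gens k|)%N.
Proof.
pose C := [set x : k | has (fun q => root (map_poly iota q) x) s] => us cs.
have : C \subset gens k.
  apply/subsetP => x; rewrite inE => /hasP[q qs]; exact/conj_poly_gens/cs.
move=> /subset_leq_card; apply: leq_trans; rewrite {}/C.
elim: s us cs => [|q s IH] /=; first by rewrite muln0.
move=> /andP[qs us] cs; set C := [set _ | _].
pose Cq := [set x : k | root (map_poly iota q) x].
pose Cs := [set x : k | has (fun q => root (map_poly iota q) x) s].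
have -> : C = Cq :|: Cs by apply/setP => x; rewrite !inE.
rewrite mulnS cardsU (_ : _ :&: _ = set0) ?cards0 ?subn0; last first.
  apply/setP => x; rewrite !inE; apply/negbTE/negP => /andP[qx /hasP[q' q's q'x]].
  move: qs; rewrite (@conj_poly_inj q q' x) ?q's //; apply: cs.
    exact: mem_head.
  by rewrite inE q's orbT.
apply: leq_add; first by apply: card_conj_roots; apply: cs; exact: mem_head.
by apply: IH => // q' q's; apply: cs; rewrite inE q's orbT.
Qed.

End FrobeniusClasses.

Lemma gens_nonempty (k : finFieldType) : exists x, x \in gens k.
Proof.
have [x _ xmin] := subr_gen (subrT k); exists x; apply/gensP => M sM xM.
by apply/eqP; rewrite eqEsubset subsetT xmin.
Qed.

Lemma gens_horner (p : nat) (k : finFieldType) (charp : p \in [pchar k]) (x z : k) :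
  x \in gens k -> exists r : {poly 'F_p}, z = (map_poly (Fp_embed charp) r).[x].
Proof.
move=> /gensP gx.
pose M : {set k} := [set z | `[< exists r : {poly 'F_p}, z = (map_poly (Fp_embed charp) r).[x] >]].
have sM : subr M.
  apply/subrP; split=> [|y w|y w]; rewrite !inE.
  - by apply/asboolP; exists 0; rewrite rmorph0 horner0.
  - move=> /asboolP[r ->] /asboolP[r' ->]; apply/asboolP; exists (r - r').
    by rewrite rmorphB hornerD hornerN.
  - move=> /asboolP[r ->] /asboolP[r' ->]; apply/asboolP; exists (r * r').
    by rewrite rmorphM hornerM.
have xM : x \in M.
  by rewrite inE; apply/asboolP; exists 'X; rewrite map_polyX hornerX.
by have := in_setT z; rewrite -(gx M sM xM) inE => /asboolP.
Qed.

(** The map sends r(x) to r(y) for polynomials r over F_p; it is well defined because q, irreducible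
    with root x, divides every polynomial vanishing at x. *)
Lemma finField_iso (p f : nat) (k k' : finFieldType) :
  prime p -> (0 < f)%N -> #|k| = (p ^ f)%N -> #|k'| = (p ^ f)%N ->
  exists h : {rmorphism k -> k'}, bijective h.
Proof.
move=> p_pr f_gt0 ck ck'.
have charp := card_finPcharP ck p_pr; have charp' := card_finPcharP ck' p_pr.
have [x xg] := gens_nonempty k; have [q cq qx] := gens_root charp ck f_gt0 xg.
have [y qy] := conj_poly_root charp' ck' cq.
pose E r := (map_poly (Fp_embed charp) r).[x].
pose E' r := (map_poly (Fp_embed charp') r).[y].
have /choice[r rE] : forall z, exists r, z = E r by move=> z; apply: gens_horner.
have EE' s : E s = 0 -> E' s = 0.
  move=> /rootP sx; apply/rootP; have /dvdpP[u ->] : q %| s.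
    by case: cq => _ iq _ _; apply: common_root_dvdp qx sx.
  by rewrite rmorphM rootM qy orbT.
have EB s t : E (s - t) = E s - E t by rewrite /E rmorphB hornerD hornerN.
have E'B s t : E' (s - t) = E' s - E' t by rewrite /E' rmorphB hornerD hornerN.
have EM s t : E (s * t) = E s * E t by rewrite /E rmorphM hornerM.
have E'M s t : E' (s * t) = E' s * E' t by rewrite /E' rmorphM hornerM.
have EE s t : E s = E t -> E' s = E' t.
  by move=> /eqP; rewrite -subr_eq0 -EB => /eqP/EE'/eqP; rewrite E'B subr_eq0 => /eqP.
pose h z := E' (r z).
have hB : zmod_morphism h by move=> a b; rewrite /h -E'B; apply: EE; rewrite EB -!rE.
have hM : monoid_morphism h.
  split=> [|a b]; last by rewrite /h -E'M; apply: EE; rewrite EM -!rE.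
  have -> : 1 = E' 1 by rewrite /E' rmorph1 hornerC.
  by apply: EE; rewrite -rE /E rmorph1 hornerC.
pose hA := GRing.isZmodMorphism.Build _ _ h hB.
pose hMM := GRing.isMonoidMorphism.Build _ _ h hM.
pose H : {rmorphism k -> k'} := HB.pack h hA hMM.
by exists H; apply: inj_card_bij; [exact: fmorph_inj | rewrite ck ck'].
Qed.

Lemma size_le_finite (F : finNzRingType) (n : nat) :
  finite_set [set q : {poly F} | (size q <= n)%N]%classic.
Proof.
apply: (@sub_finite_set _ _ (range (fun v : {ffun 'I_n -> F} => \poly_(i < n) (if insub i is Some j then v j else 0)))).
  move=> q /= szq; exists [ffun i : 'I_n => q`_i] => //.
  apply/polyP => i; rewrite coef_poly; case: ltnP => ni.
    by rewrite insubT ffunE.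
  by rewrite nth_default // (leq_trans szq).
exact: finite_image.
Qed.

Lemma conj_polys (p f : nat) : prime p -> (0 < f)%N ->
  exists s : seq {poly 'F_p}, [/\ uniq s, forall q, q \in s <-> conj_poly f q
    & (size s).+1 = tau p f].
Proof.
move=> p_pr f_gt0; rewrite /tau; case: eqP => [->|/eqP f1].
  exists [seq 'X - a%:P | a <- enum (predC1 (0 : 'F_p))]; split.
  - rewrite map_inj_uniq ?enum_uniq // => a b /polyP/(_ 0%N).
    by rewrite !coefB !coefX !coefC /= !sub0r => /oppr_inj.
  - move=> q; split=> [/mapP[a]|[mq _ szq qX]].
      rewrite mem_enum => a0 ->; split; rewrite ?monicXsubC ?size_XsubC //.
        exact: irredp_XsubC.
      by rewrite -subr_eq0 addrAC subrr sub0r oppr_eq0 polyC_eq0.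
    have q1 : q`_1 = 1 by move/monicP: mq; rewrite /lead_coef szq.
    have qE : q = 'X - (- q`_0)%:P.
      apply/polyP => -[|[|i]]; rewrite coefB coefX coefC //= ?subr0 ?opprK ?add0r //.
      by rewrite nth_default // szq.
    apply/mapP; exists (- q`_0) => //; rewrite mem_enum inE oppr_eq0.
    by apply: contraNneq qX => q0; rewrite qE q0 oppr0 subr0.
  - by rewrite size_map -cardE cardC1 card_Fp // prednK // prime_gt0.
pose E := [set q : {poly 'F_p} | [/\ q \is monic, irreducible_poly q & size q = f.+1]]%classic.
have finE : finite_set E.
  by apply: sub_finite_set (size_le_finite _ f.+1) => q /= [_ _ ->].
exists (fset_set E); split; rewrite ?fset_uniq //.
move=> q; rewrite in_fset_set // in_setE; split=> [[mq iq szq]|[mq iq szq _]] //.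
split=> //; apply: contraTneq f1 => qX; move: szq; rewrite qX size_polyX => -[<-].
by [].
Qed.

(** * Covers of powers of a finite field *)

Section GraphSubrings.
Variable k : finFieldType.
Implicit Types (G : {set k * k}) (x y : k).

(** Graphs of the automorphisms of [k], given as relations: the two coordinates play symmetric
    roles, and the image of a subring under a pair of residue maps fits without extracting a
    function. *)
Record graph_subr G : Prop := GraphSubr {
  graph_sub : forall x y x' y', (x, y) \in G -> (x', y') \in G -> (x - x', y - y') \in G;
  graph_mul : forall x y x' y', (x, y) \in G -> (x', y') \in G -> (x * x', y * y') \in G;
  graph_total : forall x, exists y, (x, y) \in G;
  graph_onto : forall y, exists x, (x, y) \in G;
  graph_ker : forall x, (x, 0) \in G -> x = 0;
  graph_coker : forall y, (0, y) \in G -> y = 0 }.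

Lemma graph_subr_sym G : graph_subr G -> graph_subr [set z | (z.2, z.1) \in G].
Proof.
move=> [B M T O K C]; split=> [x y x' y'|x y x' y'|x|y|x|y]; rewrite ?inE /=.
- exact: B.
- exact: M.
- by have [y yG] := O x; exists y; rewrite inE.
- by have [x xG] := T y; exists x; rewrite inE.
- exact: C.
- exact: K.
Qed.

Lemma graph_functional G x y y' : graph_subr G ->
  (x, y) \in G -> (x, y') \in G -> y = y'.
Proof.
move=> gG xy xy'; have := graph_sub gG xy xy'.
by rewrite subrr => /(graph_coker gG)/eqP; rewrite subr_eq0 => /eqP.
Qed.

Lemma graph_injective G x x' y : graph_subr G ->
  (x, y) \in G -> (x', y) \in G -> x = x'.
Proof.
move=> gG xy xy'; have := graph_sub gG xy xy'.
by rewrite subrr => /(graph_ker gG)/eqP; rewrite subr_eq0 => /eqP.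
Qed.

Lemma graph0 G : graph_subr G -> (0, 0) \in G.
Proof.
by move=> gG; have [y yG] := graph_total gG 0; have y0 := graph_coker gG yG; rewrite y0 in yG.
Qed.

Lemma graph1 G : graph_subr G -> (1, 1) \in G.
Proof.
move=> gG; have [y yG] := graph_total gG 1.
have y0 : y != 0.
  apply/eqP => y0; rewrite y0 in yG.
  by have /eqP := graph_ker gG yG; rewrite oner_eq0.
rewrite -{2}(expf_card_pred y0) -(expr1n _ #|k|.-1).
have : (0 < #|k|.-1)%N by rewrite -ltnS prednK ?finNzRing_gt1 ?(ltn_trans _ (finNzRing_gt1 k)).
case: (#|k|.-1) => // n _; elim: n => [|n IH]; first by rewrite !expr1.
by rewrite 2!(exprS _ n.+1); apply: graph_mul.
Qed.

Lemma graph_add G x y x' y' : graph_subr G ->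
  (x, y) \in G -> (x', y') \in G -> (x + x', y + y') \in G.
Proof.
move=> gG xy xy'; rewrite -[x']opprK -[y']opprK; apply: graph_sub => //.
by rewrite -[- x']add0r -[- y']add0r; apply: graph_sub => //; exact: graph0.
Qed.

Lemma graph_gens G x y : graph_subr G -> (x, y) \in G -> x \in gens k -> y \in gens k.
Proof.
move=> gG xyG /gensP gx; apply/gensP => M sM yM; have /subrP[M0 MB MM] := sM.
pose N := [set z | [exists w in M, (z, w) \in G]].
have sN : subr N.
  apply/subrP; split=> [|z z'|z z']; rewrite !inE.
  - by apply/exists_inP; exists 0 => //; exact: graph0.
  - move=> /exists_inP[w wM zw] /exists_inP[w' w'M zw'].
    by apply/exists_inP; exists (w - w'); [exact: MB | exact: graph_sub].
  - move=> /exists_inP[w wM zw] /exists_inP[w' w'M zw'].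
    by apply/exists_inP; exists (w * w'); [exact: MM | exact: graph_mul].
have xN : x \in N by rewrite inE; apply/exists_inP; exists y.
apply/setP => w; rewrite inE; have [z zwG] := graph_onto gG w.
have := in_setT z; rewrite -(gx N sN xN) inE => /exists_inP[w' w'M zw'].
by rewrite (graph_functional gG zwG zw').
Qed.

(** [G] contains the pairs (n, n), so it is stable under evaluation of polynomials over the prime
    field. Linked generators thus share their minimal polynomial. *)
Lemma graph_root G (p : nat) (charp : p \in [pchar k]) (q : {poly 'F_p}) x y :
  graph_subr G -> (x, y) \in G ->
  root (map_poly (Fp_embed charp) q) x -> root (map_poly (Fp_embed charp) q) y.
Proof.
move=> gG xyG; have natG n : (n%:R, n%:R) \in G.
  elim: n => [|n IH]; first exact: graph0.
  by rewrite -natr1; apply: graph_add => //; exact: graph1.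
have : ((map_poly (Fp_embed charp) q).[x], (map_poly (Fp_embed charp) q).[y]) \in G.
  elim/poly_ind: q => [|q c IH]; first by rewrite rmorph0 !horner0 graph0.
  rewrite rmorphD rmorphM /= map_polyX map_polyC !hornerMXaddC /=.
  by rewrite Fp_embedE; apply: graph_add => //; apply: graph_mul.
by move=> qG /rootP qx; apply/rootP; rewrite qx in qG; exact: (graph_coker gG qG).
Qed.

Lemma graph_Frobenius (p : nat) j : p \in [pchar k] ->
  graph_subr [set z : k * k | z.1 == z.2 ^+ (p ^ j)].
Proof.
move=> charp; have p_gt0 := prime_gt0 (pcharf_prime charp).
have pj0 : (p ^ j == 0)%N = false by rewrite expn_eq0 gtn_eqF.
split=> [x y x' y'|x y x' y'|x|y|x|y]; rewrite ?inE /=.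
- by move=> /eqP-> /eqP->; rewrite (exprB_pow charp).
- by move=> /eqP-> /eqP->; rewrite exprMn.
- have /injF_bij[g _ gK] := @expr_pow_inj _ _ charp j.
  by exists (g x); rewrite inE /= gK.
- by exists (y ^+ (p ^ j)); rewrite inE.
- by rewrite expr0n pj0 => /eqP.
- by rewrite eq_sym expf_eq0 => /andP[_ /eqP].
Qed.

End GraphSubrings.

(** * Coordinate conditions on residue vectors and the two counting bounds *)

Section ResidueCovers.
Variables (p f : nat) (k : finFieldType) (charp : p \in [pchar k]).
Hypothesis cardk : #|k| = (p ^ f)%N.
Hypothesis f_gt0 : (0 < f)%N.
Variable S : seq {poly 'F_p}.
Hypothesis S_uniq : uniq S.
Hypothesis S_conj : forall q, q \in S <-> conj_poly f q.
Local Notation iota := (Fp_embed charp).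
Local Notation W := (max_subr k).
Local Notation N := (size S).

Variant residue_shape (V : finType) := Inert of V & {set k} | Diag of V & V & {set k * k}.

Section Shapes.
Variable V : finType.
Implicit Types (s : residue_shape V) (r : {ffun V -> k}) (T : {set V}).

Definition meets r s : bool :=
  match s with Inert v M => r v \in M | Diag u v G => (r u, r v) \in G end.

Definition proper_shape s : Prop :=
  match s with
  | Inert v M => subr M /\ M != setT
  | Diag u v G => u != v /\ graph_subr G
  end.

Definition supported T s : bool :=
  match s with Inert v _ => v \in T | Diag u v _ => (u \in T) && (v \in T) end.

Definition inert_at v s : bool := if s is Inert u _ then u == v else false.

Definition diag_at v s : bool := if s is Diag u w _ then (u == v) || (w == v) else false.

(** Distinct polynomials of [S] are attached to the coordinates in [T] and a root of each is chosen:
    the roots generate [k], and a graph links roots of the same polynomial only. The threshold N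
    comes from here. *)
Lemma separating_residues T : (#|T| <= N)%N -> exists r,
  (forall v, v \in T -> r v \in gens k) /\
  (forall u v G, u \in T -> v \in T -> u != v -> graph_subr G -> (r u, r v) \notin G).
Proof.
move=> cT; pose q v := nth 0 S (index v (enum T)).
have qS v : v \in T -> q v \in S.
  by move=> vT; rewrite mem_nth // (leq_trans _ cT) // cardE index_mem mem_enum.
have /fin_all_exists[r rP] v : exists x, v \in T -> root (map_poly iota (q v)) x.
  have [vT|nT] := boolP (v \in T); last by exists 0.
  by have [x xq] := conj_poly_root charp cardk ((S_conj _).1 (qS v vT)); exists x.
exists (finfun r); split=> [v vT|u v G uT vT uv gG]; rewrite !ffunE.
  exact: (conj_poly_gens cardk ((S_conj _).1 (qS v vT)) (rP v vT)).
apply: contra uv => rG; have quv : q u = q v.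
  apply: (@conj_poly_inj _ f _ charp _ _ (r v)); last exact: rP.
  - exact/S_conj/qS.
  - exact/S_conj/qS.
  - exact: graph_root gG rG (rP u uT).
have lt w : w \in T -> (index w (enum T) < N)%N.
  by move=> wT; rewrite (leq_trans _ cT) // cardE index_mem mem_enum.
move/eqP: quv; rewrite nth_uniq ?lt // => /eqP /(congr1 (nth u (enum T))).
by rewrite !nth_index ?mem_enum // => ->.
Qed.

End Shapes.

Section LowerBound.
Variables (V I : finType) (s : I -> residue_shape V).
Hypothesis s_proper : forall i, proper_shape (s i).
Hypothesis s_covers : forall r, exists i, meets r (s i).

Let covers (T : {set V}) :=
  [forall r : {ffun V -> k}, exists i, supported T (s i) && meets r (s i)].

Let inerts (T : {set V}) v := [set i | supported T (s i) && inert_at v (s i)].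
Let diags (T : {set V}) v := [set i | supported T (s i) && diag_at v (s i)].

Lemma max_subr_generators : exists g : {set k} -> k, forall M, M \in W ->
  g M \in M /\ forall M', subr M' -> M' != setT -> g M \in M' -> M' = M.
Proof.
apply: (@fin_all_exists _ (fun=> k) (fun M x => M \in W ->
  x \in M /\ forall M', subr M' -> M' != setT -> x \in M' -> M' = M)) => M.
have [MW|nW] := boolP (M \in W); last by exists 0.
by have [x xM xmax] := max_subr_gen MW; exists x.
Qed.

(* By minimality some r0 avoids every shape supported in T :\ v. Letting the coordinate at v run
   over gens k and one generator of each maximal subring yields distinct shapes at v. *)
Lemma critical_degree T v : minset covers T -> v \in T ->
  (#|gens k| <= #|diags T v|)%N /\ (#|gens k| + #|W| <= #|inerts T v| + #|diags T v|)%N.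
Proof.
move=> /minsetP[covT minT] vT.
have : ~~ covers (T :\ v).
  apply/negP => /minT; rewrite subsetDl => /(_ isT) /setP/(_ v).
  by rewrite !inE eqxx vT.
move=> /forallPn[r0]; rewrite negb_exists => /forallP r0P.
pose r x := [ffun u => if u == v then x else r0 u].
have /fin_all_exists[idx idxP] x : exists i, supported T (s i) && meets (r x) (s i).
  by apply/existsP; exact: (forallP covT).
have [g gP] := max_subr_generators.
have rv x : r x v = x by rewrite ffunE eqxx.
have rn x u : u != v -> r x u = r0 u by rewrite ffunE => /negbTE->.
(* A shape met by [r x] but not by [r0] involves the coordinate v; if it is a [Diag], its other
   coordinate is fixed by [r0] and determines x. *)
have idx_at x : (inert_at v (s (idx x)) /\ exists2 M, s (idx x) = Inert v M & x \in M) \/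
    (diag_at v (s (idx x)) /\ forall y, idx y = idx x -> y = x).
  have := idxP x; have := r0P (idx x); have := s_proper (idx x).
  case E: (s (idx x)) => [u M|u w G] /=.
    move=> _; have [->|uv] := eqVneq u v.
      by rewrite rv => _ /andP[_ xM]; left; split=> //; exists M.
    by rewrite !inE uv rn // => /negP H /H.
  move=> [uw gG]; have [uv|uv] := eqVneq u v.
    rewrite -uv in rv rn *; rewrite eq_sym in uw; rewrite rv (rn x w) // => _ /andP[_ xG].
    right; split=> // y yE; have := idxP y; rewrite yE E /= rv (rn y w) // => /andP[_ yG].
    exact: graph_injective yG xG.
  have [wv|wv] := eqVneq w v.
    rewrite -wv in rv rn *; rewrite rv (rn x u) // => _ /andP[_ xG].
    right; split=> // y yE; have := idxP y; rewrite yE E /= rv (rn y u) // => /andP[_ yG].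
    exact: graph_functional yG xG.
  by rewrite !inE uv wv !rn // => /negP H /H.
have gens_diag x : x \in gens k -> idx x \in diags T v.
  move=> xg; rewrite inE; have /andP[-> _] := idxP x.
  have [[_ [M E xM]]|[-> _]//] := idx_at x.
  have := s_proper (idx x); rewrite E => -[sM nM].
  by move/gensP: xg => /(_ M sM xM) MT; rewrite MT eqxx in nM.
have gN M : M \in W -> g M \notin gens k.
  by move=> MW; apply/negP => /gens_max_subr/(_ MW); rewrite (gP M MW).1.
have idx_inj : {in gens k :|: g @: W &, injective idx}.
  move=> x y xB yB xy; have [[_ [M E xM]]|[_ H]] := idx_at x; last by rewrite (H y).
  have [[_ [M' E' yM']]|[_ H]] := idx_at y; last by rewrite (H x).
  have MM' : M = M' by move: E'; rewrite -xy E => -[].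
  have := s_proper (idx x); rewrite E => -[sM nM].
  have gM z : z \in M -> z \in gens k :|: g @: W -> z = g M.
    move=> zM; rewrite inE => /orP[/gensP/(_ M sM zM) MT|].
      by rewrite MT eqxx in nM.
    move=> /imsetP[M1 M1W zE]; rewrite zE; congr g.
    by apply/esym/((gP M1 M1W).2 M) => //; rewrite -zE.
  by rewrite (gM x) // (gM y) // MM'.
split.
  rewrite -(@card_in_imset _ _ idx (gens k)); last first.
    by move=> x y xg yg; apply: idx_inj; rewrite inE ?xg ?yg.
  by apply: subset_leq_card; apply/subsetP => _ /imsetP[x xg ->]; exact: gens_diag.
have cB : #|gens k :|: g @: W| = (#|gens k| + #|W|)%N.
  rewrite cardsU (_ : _ :&: _ = set0) ?cards0 ?subn0 ?card_in_imset //.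
    move=> M M' MW M'W gMM'; have [sM nM _] := max_subrP MW.
    by apply: (gP M' M'W).2; rewrite -?gMM' ?(gP M MW).1.
  apply/setP => x; rewrite !inE; apply/negbTE/negP => /andP[xg /imsetP[M MW xE]].
  by have := gN M MW; rewrite -xE inE xg.
rewrite -cB -(card_in_imset idx_inj) (leq_trans _ (leq_card_setU _ _)) //.
apply: subset_leq_card; apply/subsetP => _ /imsetP[x xB ->]; rewrite !inE.
by have /andP[-> _] := idxP x; have [[-> _]|[-> _]] := idx_at x; rewrite ?orbT.
Qed.

Lemma covers_card T : covers T -> (N < #|T|)%N.
Proof.
move=> covT; rewrite ltnNge; apply/negP => /separating_residues[r [rg rG]].
have /existsP[i /andP[sT]] := forallP covT r.
have := s_proper i; case: (s i) sT => [v M|u v G] /=.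
  by move=> vT [sM nM] /(elimT (gensP _) (rg v vT) M sM) MT; rewrite MT eqxx in nM.
by move=> /andP[uT vT] [uv gG]; rewrite (negbTE (rG _ _ _ uT vT uv gG)).
Qed.

(** With the other N coordinates filled by separated generators of [k], a generator of [M] placed at
    v cannot be linked to them, since graphs preserve generators of [k]. Only [Inert v M]
    remains. *)
Lemma covers_inerts T v : covers T -> #|T| = N.+1 -> v \in T -> (#|W| <= #|inerts T v|)%N.
Proof.
move=> covT cT vT; have [g gP] := max_subr_generators.
have [|r [rg rG]] := @separating_residues _ (T :\ v).
  by rewrite (cardsD1 v) vT add1n in cT; case: cT => ->.
have /fin_all_exists[idx idxP] M : exists i, M \in W ->
    i \in inerts T v /\ s i = Inert v M.
  have [MW|nW] := boolP (M \in W); last by have [i _] := s_covers r; exists i.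
  pose r' := [ffun u => if u == v then g M else r u].
  have /existsP[i /andP[sT ri]] := forallP covT r'; exists i => _; rewrite inE sT /=.
  have gN : g M \notin gens k.
    by apply/negP => /gens_max_subr/(_ MW); rewrite (gP M MW).1.
  have rv : r' v = g M by rewrite ffunE eqxx.
  have rn u : u != v -> r' u = r u by rewrite ffunE => /negbTE->.
  have := s_proper i; case: (s i) sT ri => [u B|u w G] /=.
    have [->|uv] := eqVneq u v => uT; rewrite ?rv ?rn // => rM [sB nB].
      by rewrite ((gP M MW).2 B).
    have ug : r u \in gens k by apply: rg; rewrite !inE uv.
    by move/gensP: ug => /(_ B sB rM) BT; rewrite BT eqxx in nB.
  move=> /andP[uT wT] ri [uw gG]; exfalso; move: ri.
  have [uv|uv] := eqVneq u v.
    rewrite uv eq_sym in uw; rewrite uv rv rn // => riG.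
    move/negP: gN; apply; apply: (graph_gens (graph_subr_sym gG)) (rg w _).
      by rewrite inE; exact: riG.
    by rewrite !inE uw.
  rewrite (rn u) //; have [wv|wv] := eqVneq w v.
    rewrite wv rv => riG; move/negP: gN; apply; apply: (graph_gens gG riG).
    by apply: rg; rewrite !inE uv.
  by rewrite rn // (negbTE (rG _ _ _ _ _ uw gG)) // !inE ?uv ?wv.
rewrite -(@card_in_imset _ _ idx W).
  by apply: subset_leq_card; apply/subsetP => _ /imsetP[M MW ->]; case: (idxP M MW).
move=> M M' MW M'W eqi; have [_ E] := idxP M MW; have [_] := idxP M' M'W.
by rewrite -eqi E => -[].
Qed.

(** Double counting: an [Inert] shape occurs at one coordinate with weight 2, a [Diag] shape at no
    more than two with weight 1. *)
Lemma degree_sum (T : {set V}) :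
  (\sum_(v in T) (2 * #|inerts T v| + #|diags T v|) <= 2 * #|I|)%N.
Proof.
have cE (P : pred I) : #|[set i | P i]| = (\sum_i P i)%N.
  by rewrite -sum1_card big_mkcond /=; apply: eq_bigr => i _; rewrite inE; case: (P i).
apply: (@leq_trans (\sum_(v in T) \sum_i (2 * inert_at v (s i) + diag_at v (s i)))%N).
  apply: leq_sum => v _; rewrite !cE big_split /= -big_distrr /=.
  by rewrite leq_add ?leq_mul // leq_sum // => i _; case: supported => //; case: (_ (s i)).
rewrite exchange_big /= mulnC -sum1_card big_distrl /=; apply: leq_sum => i _.
rewrite mul1n big_mkcond /=.
apply: (@leq_trans (\sum_v (2 * inert_at v (s i) + diag_at v (s i)))%N).
  by apply: leq_sum => v _; case: ifP.
have sum1 (u : V) : (\sum_v (u == v))%N = 1%N.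
  rewrite (bigD1 u) //= eqxx big1 ?addn0 // => v; rewrite eq_sym => /negbTE->.
  by [].
case: (s i) => [u M|u w G] /=.
  rewrite (eq_bigr (fun v => 2 * (u == v))%N) => [|v _]; last by rewrite addn0.
  by rewrite -big_distrr /= sum1.
apply: (@leq_trans (\sum_v ((u == v) + (w == v)))%N).
  by apply: leq_sum => v _; case: eqP; case: eqP.
by rewrite big_split /= !sum1.
Qed.

Theorem residue_cover_bound :
  (N < #|V|)%N /\ (N.+1 * (2 * #|W| + f * N) <= 2 * #|I|)%N.
Proof.
have covT : covers setT.
  apply/forallP => r; have [i ri] := s_covers r; apply/existsP; exists i.
  by rewrite ri andbT; case: (s i) => [u M|u w G] /=; rewrite !inE.
split; first by rewrite -cardsT covers_card.
have [T minT _] := minset_exists covT.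
have cT : covers T by case/minsetP: minT.
have gens_ge : (f * N <= #|gens k|)%N.
  by apply: (card_gens_ge charp cardk S_uniq) => q /S_conj.
have W_le : (#|W| <= f)%N := card_max_subr (pcharf_prime charp) cardk.
apply: leq_trans (degree_sum T).
(* On exactly N + 1 coordinates inert and diagonal shapes are bounded separately; on more, only
   their sum is bounded at each coordinate, and the additional coordinates compensate. *)
have [cT1|cT2] := leqP #|T| N.+1.
  have eT : #|T| = N.+1 by apply/anti_leq; rewrite cT1 covers_card.
  rewrite -eT -sum_nat_const; apply: leq_sum => v vT.
  have [d_ge _] := critical_degree minT vT.
  by rewrite leq_add ?(leq_trans gens_ge) // leq_mul // covers_inerts.
(* Here #|T| >= N + 2, and (N+2)(fN+w) - (N+1)(2w+fN) = N(f-w) >= 0. *)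
apply: (@leq_trans (#|T| * (f * N + #|W|))).
  by nia.
rewrite -sum_nat_const; apply: leq_sum => v vT.
have [_ d_ge] := critical_degree minT vT.
by lia.
Qed.

End LowerBound.

Section UpperBound.
Variables (R : comPzRingType) (V : finType) (pi : V -> {rmorphism R -> k}).
Hypothesis pi_onto : forall r : V -> k, exists x, forall v, pi v x = r v.

Lemma proper_shape_subring (s : residue_shape V) : proper_shape s ->
  proper_subring [pred x | meets [ffun v => pi v x] s].
Proof.
case: s => [v M [/subrP[M0 MB MM] nM]|u v G [uv gG]].
  split; last first.
    have [y yM] : exists y, y \notin M.
      by apply/existsP; apply: contraT => /existsPn H; case/eqP: nM; apply/setP => y;
         have := H y; rewrite inE negbK => ->.
    by have [x xP] := pi_onto (fun=> y); exists x; rewrite !inE /= ffunE xP.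
  split; first split; rewrite ?inE /= ?ffunE ?rmorph0 // => x y; rewrite !inE /= !ffunE.
    by rewrite rmorphB; exact: MB.
  by rewrite rmorphM; exact: MM.
split; last first.
  have [x xP] := pi_onto (fun w => (w == u)%:R); exists x.
  rewrite !inE /= !ffunE !xP eqxx eq_sym (negbTE uv); apply/negP => /(graph_ker gG)/eqP.
  by rewrite oner_eq0.
split; first split; rewrite ?inE /= ?ffunE ?rmorph0 ?graph0 // => x y; rewrite !inE /= !ffunE.
  by rewrite !rmorphB; exact: graph_sub.
by rewrite !rmorphM; exact: graph_mul.
Qed.

(** Either some coordinate lies in a maximal subring, or all N + 1 of them generate [k]; then two
    share a minimal polynomial by pigeonhole and are Frobenius conjugates. *)
Lemma residue_cover_exists : #|V| = N.+1 ->
  exists2 n, covered_by R n & (2 * n = N.+1 * (2 * #|W| + f * N))%N.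
Proof.
move=> cV; pose rk := @enum_rank V.
pose J1 := (V * {M : {set k} | M \in W})%type.
(* Ordering by rank lists each unordered pair once; one direction suffices, as the inverse of a
   Frobenius power is a Frobenius power. *)
pose J2 := ({z : V * V | rk z.1 < rk z.2}%N * 'I_f)%type.
pose s (j : J1 + J2) : residue_shape V := match j with
  | inl (v, M) => Inert v (val M)
  | inr (z, e) => Diag (val z).1 (val z).2 [set w : k * k | w.1 == w.2 ^+ (p ^ e)]
  end.
have s_proper j : proper_shape (s j).
  case: j => [[v M]|[z e]] /=.
    by have [sM nM _] := max_subrP (valP M).
  split; last exact: graph_Frobenius.
  by apply: contraTneq (valP z) => ->; rewrite ltnn.
have s_covers r : exists j, meets r (s j).
  have [/existsP[v vN]|/existsPn r_gen] := boolP [exists v, r v \notin gens k].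
    have [M MW rM] := notin_gens vN.
    by exists (inl (v, exist _ M MW)).
  have {}r_gen v : r v \in gens k by have := r_gen v; rewrite negbK.
  have /fin_all_exists[q qP] v : exists q, conj_poly f q /\ root (map_poly iota q) (r v).
    by have [q cq qr] := gens_root charp cardk f_gt0 (r_gen v); exists q.
  have /injectivePn[u [v uv quv]] : ~~ injectiveb q.
    apply/negP => /injectiveP q_inj.
    have : (#|V| <= size S)%N.
      rewrite -(size_image q predT); apply: uniq_leq_size.
        by rewrite map_inj_uniq ?enum_uniq.
      by move=> _ /imageP[v _ ->]; apply/S_conj; case: (qP v).
    by rewrite cV ltnn.
  wlog uv_lt : u v uv quv / (rk u < rk v)%N.
    move=> H; have [uv'|vu|/val_inj/enum_rank_inj uv'] := ltngtP (rk u) (rk v).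
    - exact: (H u v).
    - by apply: (H v u) => //; rewrite eq_sym.
    - by rewrite uv' eqxx in uv.
  have [cq qu] := qP u; have [_ qv] := qP v.
  rewrite quv in cq qu.
  have [e rE] := conj_poly_roots cardk cq qv qu.
  by exists (inr (exist _ (u, v) uv_lt, e)); rewrite /= inE /= rE.
pose n := #|{: J1 + J2}|; exists n.
  exists (fun (i : 'I_n) x => meets [ffun v => pi v x] (s (enum_val i))).
  split=> [i|x]; first exact: proper_shape_subring.
  have [j jP] := s_covers [ffun v => pi v x].
  by exists (enum_rank j); rewrite unfold_in enum_rankK.
have cP : (2 * #|{: {z : V * V | (rk z.1 < rk z.2)%N}}| = N.+1 * N)%N.
  rewrite card_sig -cV.
  pose lt := [set z : V * V | (rk z.1 < rk z.2)%N].
  pose gt := [set z : V * V | (rk z.2 < rk z.1)%N].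
  pose eq := [set z : V * V | z.1 == z.2].
  have -> : #|[pred z : V * V | (rk z.1 < rk z.2)%N]| = #|lt|.
    by apply: eq_card => z; rewrite !inE.
  have gtE : #|gt| = #|lt|.
    have sw_inj : injective (fun z : V * V => (z.2, z.1)) by move=> [? ?] [? ?] [-> ->].
    rewrite -(card_imset _ sw_inj); apply: eq_card => -[a b]; rewrite !inE /=.
    by apply/imsetP/idP => [[[c d]]|ab]; [rewrite !inE /= => ? [-> ->]|exists (b, a); rewrite ?inE].
  have eqE : #|eq| = #|V|.
    have d_inj : injective (fun v : V => (v, v)) by move=> ? ? [].
    rewrite -cardsT -(card_imset _ d_inj); apply: eq_card => -[a b]; rewrite !inE /=.
    by apply/eqP/imsetP => [->|[c _ [-> ->]]//]; exists b.
  have tot : (#|lt| + #|gt| + #|eq| = #|V| * #|V|)%N.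
    rewrite -card_prod -cardsT (_ : setT = lt :|: gt :|: eq); last first.
      apply/setP => -[a b]; rewrite !inE /=.
      by case: ltngtP => //= /val_inj/enum_rank_inj->; rewrite eqxx.
    rewrite cardsU (_ : _ :&: eq = set0) ?cards0 ?subn0; last first.
      apply/setP => -[a b]; rewrite !inE /=; have [->|] := eqVneq a b; last by rewrite andbF.
      by rewrite ltnn.
    rewrite cardsU (_ : lt :&: gt = set0) ?cards0 ?subn0 //.
    by apply/setP => -[a b]; rewrite !inE /=; case: ltngtP.
  move: tot; rewrite gtE eqE cV; nia.
have cW : #|{: {M : {set k} | M \in W}}| = #|W| by rewrite card_sig; apply: eq_card.
rewrite /n card_sum !card_prod card_ord cW mulnDr.
have -> : (#|V| * #|W| = N.+1 * #|W|)%N by rewrite cV.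
by rewrite [X in (_ + X)%N]mulnA cP; nia.
Qed.

End UpperBound.
End ResidueCovers.

(** * Prime ideals above p *)

Section FiniteQuotient.
Variables (R : comNzRingType) (p n : nat) (rep : 'I_n -> R).
Hypothesis repP : forall a, exists i c, a = rep i + p%:R * c.
Implicit Types (I J : {pred R}) (P Q : prime_idealr R).

Definition ideal_above I : Prop :=
  [/\ {in I &, forall x y, x + y \in I}, forall a x, x \in I -> a * x \in I
    & forall a, p%:R * a \in I].

(** An ideal containing p is a union of residue classes modulo p, hence determined by the
    representatives it contains; this makes such ideals finite in number. *)
Let code I : {set 'I_n} := [set i | rep i \in I].

Lemma code_sub I J : ideal_above I -> ideal_above J ->
  code I \subset code J -> {subset I <= J}.
Proof.
move=> [ID IM Ip] [JD JM Jp] /subsetP IJ x xI; have [i [c xE]] := repP x.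
rewrite xE; apply: JD => //; have /IJ : i \in code I.
  by rewrite inE (_ : rep i = x + p%:R * - c) ?ID // xE mulrN addrK.
by rewrite inE.
Qed.

(** Finiteness of the codes takes the place of Zorn's lemma. [C] is arbitrary because it will be
    instantiated by proper ideals and, in [associated_prime], by annihilators. *)
Lemma max_ideal_above (C : {pred R} -> Prop) I :
    (forall J, C J -> ideal_above J) -> C I ->
  exists2 J, C J & {subset I <= J} /\ (forall J', C J' -> {subset J <= J'} -> {subset J' <= J}).
Proof.
move=> Cideal CI; pose D (B : {set 'I_n}) := `[< exists2 J, C J & B = code J >].
have [|B /maxsetP[/asboolP[J CJ BE] maxJ] IB] := @maxset_exists _ D (code I).
  by apply/asboolP; exists I.
exists J => //; split.
  by apply: code_sub; rewrite -?BE //; apply: Cideal.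
move=> J' CJ' JJ'; apply: code_sub; try exact: Cideal.
rewrite -BE -(maxJ (code J')) //; first by apply/asboolP; exists J'.
by rewrite BE; apply/subsetP => i; rewrite !inE; exact: JJ'.
Qed.

Lemma prime_ideal_above I : ideal_above I -> 1 \notin I ->
  exists P, {subset I <= P} /\ p%:R \in P.
Proof.
move=> iI I1; have [||J [iJ J1] [IJ maxJ]] :=
  @max_ideal_above (fun J => ideal_above J /\ 1 \notin J) I; first by move=> ? [].
  by [].
have [JD JM Jp] := iJ.
have J0 : 0 \in J by rewrite -(mulr0 p%:R).
have idJ : idealr_closed J by split=> // a x y xJ yJ; apply: JD => //; exact: JM.
have prJ : prime_idealr_closed J.
  move=> x y xyJ; apply/orP; have [xJ|xJ] := boolP (x \in J); [by left|right].
  pose J' : {pred R} := fun z => `[< exists a u, u \in J /\ z = u + a * x >].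
  have iJ' : ideal_above J'.
    split.
    - move=> _ _ /asboolP[a [u [uJ ->]]] /asboolP[b [v [vJ ->]]]; apply/asboolP.
      by exists (a + b), (u + v); rewrite mulrDl addrACA; split=> //; exact: JD.
    - move=> b _ /asboolP[a [u [uJ ->]]]; apply/asboolP.
      by exists (b * a), (b * u); rewrite mulrDr mulrA; split=> //; exact: JM.
    - by move=> a; apply/asboolP; exists 0, (p%:R * a); rewrite mul0r addr0.
  have JJ' : {subset J <= J'}.
    by move=> z zJ; apply/asboolP; exists 0, z; rewrite mul0r addr0.
  have : 1 \in J'.
    apply: contraR xJ => J'1; apply: (maxJ J') => //.
    by apply/asboolP; exists 1, 0; rewrite mul1r add0r.
  move=> /asboolP[a [u [uJ oneE]]].
  rewrite -(mul1r y) oneE mulrDl JD //; first by rewrite mulrC JM.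
  by rewrite -mulrA JM.
pose iM := isIdealr.Build R J idJ.
pose pM := isPrimeIdealrClosed.Build R J prJ.
pose P : prime_idealr R := HB.pack J iM pM.
by exists P; split=> //; have := Jp 1; rewrite mulr1.
Qed.

Lemma pigeonhole_mod (u : nat -> R) : exists i d c, u (i + d.+1)%N = u i + p%:R * c.
Proof.
have /choice[h hP] : forall m, exists i, exists c, u m = rep i + p%:R * c.
  by move=> m; have [i [c uE]] := repP (u m); exists i, c.
have /injectivePn[i [j ij hij]] : ~~ injectiveb (fun m : 'I_n.+1 => h m).
  apply/negP => /injectiveP h_inj; have := leq_card _ h_inj.
  by rewrite !card_ord ltnn.
wlog lt_ij : i j ij hij / (i < j)%N.
  move=> H; have [|ji|/val_inj e] := ltngtP i j; first exact: (H i j).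
    by apply: (H j i) => //; rewrite eq_sym.
  by rewrite e eqxx in ij.
have [[c uiE] [d ujE]] := (hP i, hP j).
exists i, (j - i.+1)%N, (d - c); rewrite addnS -addSn subnKC // ujE uiE hij.
by ring.
Qed.

(** Two powers of x agree modulo p, so x^i (x^(d+1) - 1) lies in [P]; primality cancels x^i, and x^d
    is the inverse. *)
Lemma prime_inverse P x : p%:R \in P -> x \notin P -> exists y, x * y - 1 \in P.
Proof.
move=> pP xP; have [i [d [c E]]] := pigeonhole_mod (fun m => x ^+ m).
have xiP : x ^+ i \notin P.
  by elim: i {E} => [|i IH]; rewrite ?expr0 ?idealr1 // exprS prime_idealrM negb_or xP.
exists (x ^+ d); have : x ^+ i * (x * x ^+ d - 1) \in P.
  rewrite mulrBr mulr1 -exprS -exprD E addrAC subrr add0r mulrC idealMr //.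
by rewrite prime_idealrM (negbTE xiP).
Qed.

Lemma prime_sub_eq P Q : p%:R \in P -> {subset P <= Q} -> P =i Q.
Proof.
move=> pP PQ x; apply/idP/idP; first exact: PQ.
apply: contraLR => xP; have [y /PQ yQ] := prime_inverse pP xP.
apply/negP => xQ; have := idealr1 Q; rewrite -[1](subKr (x * y)) rpredB //.
by rewrite mulrC idealMr.
Qed.

Section ChineseRemainder.
Variables (T : finType) (P : T -> prime_idealr R).
Hypothesis pP : forall i, p%:R \in P i.
Hypothesis P_inj : forall i j, P i =i P j -> i = j.

(** A product of elements of the other primes that avoid [P i], times its inverse modulo [P i]. *)
Lemma prime_idempotent i : exists e, e - 1 \in P i /\ forall j, j != i -> e \in P j.
Proof.
have /fin_all_exists[x xP] j : exists x, j != i -> x \in P j /\ x \notin P i.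
  have [->|ji] := eqVneq j i; first by exists 0.
  have [x [xPj xPi]] : exists x, x \in P j /\ x \notin P i.
    apply: contrapT => H; case/eqP: ji; apply: P_inj; apply: prime_sub_eq => // y yPj.
    by apply/negPn/negP => yPi; apply: H; exists y.
  by exists x.
have prod_i : \prod_(j | j != i) x j \notin P i.
  apply: (big_ind (fun y => y \notin P i)); first by rewrite idealr1.
    by move=> y z yP zP; rewrite prime_idealrM negb_or yP.
  by move=> j /xP[].
have [y yP] := prime_inverse (pP i) prod_i.
exists ((\prod_(j | j != i) x j) * y); split=> // j ji.
by rewrite mulrC idealMr // (bigD1 j) //= mulrC idealMr //; case: (xP j ji).
Qed.

Lemma residues_onto (a : T -> R) : exists x, forall i, x - a i \in P i.
Proof.
have /fin_all_exists[e eP] i := prime_idempotent i.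
exists (\sum_j a j * e j) => i; rewrite (bigD1 i) //= addrAC rpredD //.
  by rewrite -{2}[a i]mulr1 -mulrBr idealMr //; case: (eP i).
by apply: rpred_sum => j ji; rewrite idealMr //; apply: (eP j).2; rewrite eq_sym.
Qed.

End ChineseRemainder.

Lemma primes_above_enum : exists (t : nat) (P : 'I_t -> prime_idealr R),
  [/\ forall i, p%:R \in P i, forall i j, P i =i P j -> i = j
    & forall Q, p%:R \in Q -> exists i, Q =i P i].
Proof.
have above Q : p%:R \in Q -> ideal_above Q.
  move=> pQ; split=> [x y xQ yQ|a x xQ|a]; first exact: rpredD.
    exact: idealMr.
  by rewrite mulrC idealMr.
have code_inj Q Q' : p%:R \in Q -> p%:R \in Q' -> code Q = code Q' -> Q =i Q'.
  move=> pQ pQ' eQ x; apply/idP/idP; apply: code_sub; rewrite ?eQ //; exact: above.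
pose D := [set B : {set 'I_n} | `[< exists2 Q : prime_idealr R, p%:R \in Q & B = code Q >]].
have H (i : 'I_#|D|) : exists Q, p%:R \in Q /\ enum_val i = code Q.
  by have := enum_valP i; rewrite inE => /asboolP[Q pQ iE]; exists Q.
have [P PP] := fin_all_exists H.
exists #|D|, P; split=> [i|i j ij|Q pQ]; first by case: (PP i).
  apply: enum_val_inj; rewrite (PP i).2 (PP j).2; apply/setP => a.
  by rewrite !inE ij.
have QD : code Q \in D by rewrite inE; apply/asboolP; exists Q.
exists (enum_rank_in QD (code Q)); apply: code_inj => //; first exact: (PP _).1.
by rewrite -(PP _).2 enum_rankK_in.
Qed.

(* The pigeonhole relation h^i (1 - h^d) = 0 mod p, together with the fact that
   1 - h^d lies in no prime ideal above p, makes h nilpotent mod p. *)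
Lemma radical_nilpotent (h : R) : (forall Q, p%:R \in Q -> h \in Q) ->
  exists m c, h ^+ m = p%:R * c.
Proof.
move=> hQ; have [i [d [c E]]] := pigeonhole_mod (fun m => h ^+ m).
pose v := 1 - h ^+ d.+1.
pose I : {pred R} := fun z => `[< exists a b : R, z = a * v + p%:R * b >].
have iI : ideal_above I.
  split.
  - move=> _ _ /asboolP[a [b ->]] /asboolP[a' [b' ->]]; apply/asboolP.
    by exists (a + a'), (b + b'); ring.
  - move=> z _ /asboolP[a [b ->]]; apply/asboolP.
    by exists (z * a), (z * b); ring.
  - by move=> a; apply/asboolP; exists 0, a; rewrite mul0r add0r.
have [|nI1] := boolP (1 \in I).
  move=> /asboolP[a [b oneE]]; exists i, (b * h ^+ i - a * c).
  rewrite -[LHS]mul1r [X in X * _]oneE; have -> : (a * v + p%:R * b) * h ^+ i =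
    a * (h ^+ i - h ^+ (i + d.+1)) + p%:R * b * h ^+ i by rewrite exprD /v; ring.
  by rewrite E; ring.
have [Q [IQ pQ]] := prime_ideal_above iI nI1.
have vQ : v \in Q by apply: IQ; apply/asboolP; exists 1, 0; rewrite mul1r mulr0 addr0.
by have := idealr1 Q; rewrite -[1](subrK (h ^+ d.+1)) rpredD // exprSr idealMr ?hQ.
Qed.

End FiniteQuotient.

(** * Finiteness of the ring of integers modulo p *)

Section RingOfIntegersModP.
Variables (K : fieldExtType rat).
Local Notation A := (ring_int K).

Lemma int_eq0 (m : int) : (m%:~R == 0 :> A) = (m == 0).
Proof.
apply/eqP/eqP => [/(congr1 val)|->]; last by rewrite rmorph0.
rewrite rmorph_int rmorph0 => /eqP; rewrite -(rmorph_int (GRing.in_alg K)) fmorph_eq0.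
by rewrite intr_eq0 => /eqP.
Qed.

Lemma int_mulI (m : int) (a : A) : m != 0 -> m%:~R * a = 0 -> a = 0.
Proof.
move=> m0 /(congr1 val); rewrite rmorphM rmorph0 => /eqP; rewrite mulf_eq0.
have : (m%:~R : A) != 0 by rewrite int_eq0.
rewrite -(inj_eq val_inj) rmorph0 => /negbTE-> /= /eqP a0; apply: val_inj.
by rewrite rmorph0; exact: a0.
Qed.

Lemma nat_mulI (n : nat) (a b : A) : (0 < n)%N -> n%:R * a = n%:R * b -> a = b.
Proof.
move=> n0 /eqP; rewrite -subr_eq0 -mulrBr => /eqP H; apply/eqP.
rewrite -subr_eq0; apply/eqP; apply: (@int_mulI n) => //.
by case: n n0 H.
Qed.

Lemma rat_relation (m : nat) (b : 'I_m -> A) : (\dim {: K} < m)%N ->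
  exists c : 'I_m -> int, \sum_i (c i)%:~R * b i = 0 /\ exists i, c i != 0.
Proof.
move=> dm; pose X := [tuple (b i : K) | i < m].
have nfree : ~~ free X.
  by apply/negP => /eqP fX; have := dimvS (subvf <<X>>%VS); rewrite fX size_tuple leqNgt dm.
have : ~ (forall k : 'I_m -> rat, \sum_(i < m) k i *: X`_i = 0 -> forall i, k i = 0).
  by move/freeP; apply/negP.
move=> /existsNP[k /not_implyP[kE /existsNP[i0 ki0]]].
pose D := \prod_i denq (k i).
(* [c i] is D times [k i], written as an integer by cancelling the denominator of [k i] in D. *)
pose c i := numq (k i) * \prod_(j | j != i) denq (k j).
have cE i : (c i)%:~R = D%:~R * k i.
  by rewrite /D [X in X%:~R * _](bigD1 i) //= /c !intrM numqE; ring.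
exists c; split; last first.
  exists i0; rewrite -(intr_eq0 rat) cE mulf_neq0 //; last exact/eqP.
  by rewrite intr_eq0; apply/prodf_neq0 => i _; rewrite denq_eq0.
apply: val_inj; rewrite rmorph_sum rmorph0.
transitivity (D%:~R *: \sum_(i < m) k i *: X`_i); last by rewrite kE scaler0.
rewrite scaler_sumr; apply: eq_bigr => i _.
rewrite rmorphM rmorph_int scalerA -cE -tnth_nth tnth_mktuple /=.
by rewrite -[in RHS](mul1r (b i : K)) scalerAl -(rmorph_int (GRing.in_alg K)).
Qed.

Variables (p : nat) (p_pr : prime p).

Definition indep_mod (m : nat) (b : 'I_m -> A) : Prop :=
  forall c : 'I_m -> int, (exists z, \sum_i (c i)%:~R * b i = p%:R * z) ->
  forall i, (p %| c i)%Z.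

(** Infinite descent: in an integral relation with the least sum of absolute values all coefficients
    would be divisible by p, and since A has no torsion the relation could be divided by p. *)
Lemma indep_mod_dim m (b : 'I_m -> A) : indep_mod b -> (m <= \dim {: K})%N.
Proof.
move=> b_ind; rewrite leqNgt; apply/negP => /rat_relation-/(_ b) rel.
pose Q s := `[< exists c : 'I_m -> int, [/\ \sum_i (c i)%:~R * b i = 0,
  exists i, c i != 0 & (\sum_i `|c i|)%N = s] >].
have exQ : exists s, Q s.
  by have [c [cE c0]] := rel; exists (\sum_i `|c i|)%N; apply/asboolP; exists c.
case: (ex_minnP exQ) => s /asboolP[c [cE [i0 ci0] sE]] smin.
have pc : forall i, (p %| c i)%Z by apply: b_ind; exists 0; rewrite cE mulr0.
pose c' i := (c i %/ p)%Z.
have cc' i : c i = c' i * p%:Z by rewrite divzK.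
have c'i0 : c' i0 != 0 by apply: contraNneq ci0 => e; rewrite cc' e mul0r.
have : Q (\sum_i `|c' i|)%N.
  apply/asboolP; exists c'; split=> //; last by exists i0.
  apply: (@int_mulI p); first by rewrite eqz_nat -lt0n prime_gt0.
  rewrite -[RHS]cE mulr_sumr; apply: eq_bigr => i _.
  by rewrite [in RHS]cc' rmorphM /= mulrA [p%:~R * _]mulrC.
move=> /smin; rewrite -sE leqNgt => /negP; apply.
have lt i : (`|c' i| <= `|c i|)%N.
  by rewrite cc' abszM leq_pmulr // prime_gt0.
rewrite (bigD1 i0) //= [ltnRHS](bigD1 i0) //= -addSn leq_add ?leq_sum //.
by rewrite [in leqRHS]cc' abszM ltn_Pmulr ?prime_gt1 // lt0n absz_eq0.
Qed.

(** A family independent modulo p of maximal length spans A/pA, so its combinations with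
    coefficients below p represent every class. *)
Lemma int_quot_finite : exists n (rep : 'I_n -> A),
  forall a, exists i c, a = rep i + p%:R * c.
Proof.
pose Q m := `[< exists b : 'I_m -> A, indep_mod b >].
have exQ : exists m, Q m.
  by exists 0%N; apply/asboolP; exists (fun _ => 0) => c _ [].
have Qle m : Q m -> (m <= \dim {: K})%N by move=> /asboolP[b /indep_mod_dim].
case: (ex_maxnP exQ Qle) => m /asboolP[b b_ind] mmax.
pose E := {ffun 'I_m -> 'I_p}.
exists #|E|, (fun i => \sum_j ((enum_val i : E) j : nat)%:R * b j) => a.
pose b' (i : 'I_m.+1) := if unlift ord_max i is Some j then b j else a.
(* By maximality the family extended by [a] is dependent, and the coefficient of [a] is prime to p
   because [b] is independent; a Bezout relation then inverts it. *)
have [c [[z cE] ncl]] : exists c : 'I_m.+1 -> int,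
    (exists z, \sum_i (c i)%:~R * b' i = p%:R * z) /\ ~~ (p %| c ord_max)%Z.
  apply: contrapT => H; have : ~~ Q m.+1.
    by apply/negP => /mmax; rewrite ltnn.
  move=> /asboolP; apply; exists b' => c cE.
  have pl : (p %| c ord_max)%Z.
    by apply/negPn/negP => ncl; apply: H; exists c.
  have /b_ind pc : exists z, \sum_i (c (lift ord_max i))%:~R * b i = p%:R * z.
    have [z zE] := cE; exists (z - (c ord_max %/ p)%Z%:~R * a).
    rewrite mulrBr -zE [in RHS](bigD1_ord ord_max) //= /b' unlift_none.
    rewrite -{1}(divzK pl) rmorphM /= -mulrA mulrCA [X in X - _]addrC addrK.
    by apply: eq_bigr => i _; rewrite liftK.
  by move=> i; case: (unliftP ord_max i) => [j ->|->].
have cop : coprimez p (c ord_max) by rewrite coprimezE prime_coprime.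
have [[u v] /= uv1] := coprimezP _ _ cop.
pose d i := - v * c (lift ord_max i).
have aE : a = \sum_i (d i)%:~R * b i + p%:R * (u%:~R * a + v%:~R * z).
  have zE : p%:R * z = (c ord_max)%:~R * a + \sum_i (c (lift ord_max i))%:~R * b i.
    rewrite -cE (bigD1_ord ord_max) //= {1}/b' unlift_none; congr (_ + _).
    by apply: eq_bigr => i _; rewrite /b' liftK.
  have -> : \sum_i (d i)%:~R * b i = - v%:~R * \sum_i (c (lift ord_max i))%:~R * b i.
    rewrite mulr_sumr; apply: eq_bigr => i _.
    by rewrite /d rmorphM rmorphN mulrA.
  rewrite mulrDr [p%:R * (v%:~R * z)]mulrCA zE.
  have : (u * p + v * c ord_max)%:~R = 1 :> A by rewrite uv1.
  rewrite rmorphD !rmorphM /= -pmulrn => one; rewrite -[LHS]mul1r -[X in X * _ = _]one.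
  by ring.
have p0 : (p : int) != 0 by rewrite eqz_nat -lt0n prime_gt0.
have modP i : (`|(d i %% p)%Z| < p)%N.
  by rewrite -ltz_nat gez0_abs ?modz_ge0 // ltz_pmod // ltz_nat prime_gt0.
pose e : E := [ffun i => Ordinal (modP i)].
exists (enum_rank e), (\sum_i (d i %/ p)%Z%:~R * b i + (u%:~R * a + v%:~R * z)).
rewrite enum_rankK mulrDr addrA [LHS]aE; congr (_ + _).
rewrite mulr_sumr -big_split; apply: eq_bigr => i _ /=.
rewrite ffunE /= mulrA -mulrDl; congr (_ * _).
rewrite {1}(divz_eq (d i) p) rmorphD rmorphM /= addrC mulrC; congr (_ + _).
by rewrite -[in LHS](gez0_abs (modz_ge0 _ p0)) -pmulrn.
Qed.

End RingOfIntegersModP.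

Lemma exprD_mod_prime (R : comNzRingType) (p : nat) (x y : R) : prime p ->
  exists c, (x + y) ^+ p = x ^+ p + y ^+ p + p%:R * c.
Proof.
move=> p_pr; have p0 := prime_gt0 p_pr; rewrite exprDn.
case: p p0 p_pr => // p _ p_pr; rewrite big_ord_recl big_ord_recr /=.
rewrite subn0 bin0 mulr1n expr0 mulr1 /bump /= add1n subnn binn expr0 mul1r mulr1n.
have [F FE] : exists F, forall i : 'I_p,
    x ^+ (p.+1 - (1 + i)) * y ^+ (1 + i) *+ 'C(p.+1, 1 + i) = p.+1%:R * F i.
  apply: (@fin_all_exists _ (fun=> R) (fun i c => _ = p.+1%:R * c)) => i.
  have /dvdnP[m ->] : (p.+1 %| 'C(p.+1, 1 + i))%N.
    by rewrite prime_dvd_bin //= add1n ltnS ltn_ord.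
  exists (x ^+ (p.+1 - (1 + i)) * y ^+ (1 + i) *+ m).
  by rewrite mulrnA [RHS]mulr_natl.
exists (\sum_i F i); rewrite mulr_sumr -addrA; congr (_ + _); rewrite addrC; congr (_ + _).
by apply: eq_bigr => i _; rewrite -FE.
Qed.

Lemma exprD_mod_prime_pow (R : comNzRingType) (p e : nat) (x y : R) : prime p ->
  exists c, (x + y) ^+ (p ^ e) = x ^+ (p ^ e) + y ^+ (p ^ e) + p%:R * c.
Proof.
move=> p_pr; elim: e => [|e [c IH]]; first by exists 0; rewrite !expr1 mulr0 addr0.
rewrite !expnSr !exprM IH.
have [d ->] := exprD_mod_prime (x ^+ (p ^ e) + y ^+ (p ^ e)) (p%:R * c) p_pr.
have [d' ->] := exprD_mod_prime (x ^+ (p ^ e)) (y ^+ (p ^ e)) p_pr.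
exists (d' + p%:R ^+ p.-1 * c ^+ p + d); rewrite exprMn.
have -> : p%:R ^+ p = p%:R * p%:R ^+ p.-1 :> R by rewrite -exprS prednK // prime_gt0.
by rewrite !mulrDr !mulrA !addrA.
Qed.

(** * Local generators of primes and residue fields *)

Section PrimesAboveP.
Variables (K : fieldExtType rat) (p : nat) (p_pr : prime p).
Local Notation A := (ring_int K).
Implicit Type P : prime_idealr A.

(** Among the annihilators contained in [P] of classes in A/pA, a maximal one, that of w, equals
    [P]. For x in [P], some c outside [P] with c x w in pA puts x in ann(c w), which maximality puts
    inside ann(w). Without such c, all ann(x^i w) would lie in ann(w), and a pigeonhole relation
    would put 1 - x^(d+1) in [P]. *)
Lemma associated_prime P : p%:R \in P ->
  exists b : A, (forall c, b <> p%:R * c) /\ forall x, x \in P -> exists c, b * x = p%:R * c.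
Proof.
move=> pP; have [n [rep repP]] := int_quot_finite K p_pr.
pose ann (w : A) : {pred A} := fun c => `[< exists z, c * w = p%:R * z >].
have annA w : ideal_above p (ann w).
  split=> [x y /asboolP[z zE] /asboolP[t tE]|a x /asboolP[z zE]|a]; apply/asboolP.
  - by exists (z + t); rewrite mulrDl zE tE mulrDr.
  - by exists (a * z); rewrite -mulrA zE mulrCA.
  - by exists (a * w); rewrite mulrA.
pose C (J : {pred A}) := exists w, J = ann w /\ {subset ann w <= P}.
have [||_ [w [-> wP]] [_ wmax]] := @max_ideal_above _ _ _ _ repP C (ann 1).
- by move=> _ [w [-> _]].
- exists 1; split=> // x /asboolP[z]; rewrite mulr1 => ->.
  by rewrite mulrC idealMr.
exists w; split=> [c wE|x xP].
  by have := idealr1 P; rewrite wP //; apply/asboolP; exists c; rewrite mul1r.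
suff : x \in ann w by move=> /asboolP[z zE]; exists z; rewrite mulrC.
have [sub|/existsNP[c /not_implyP[cxw cP]]] := pselect {subset ann (x * w) <= P}.
  have annX i : {subset ann (x ^+ i * w) <= ann w}.
    elim: i => [|i IH] c; first by rewrite expr0 mul1r.
    move=> cw; have : c * x \in ann (x ^+ i * w).
      by move/asboolP: cw => [z zE]; apply/asboolP; exists z; rewrite -zE exprS !mulrA.
    move=> /IH/asboolP[z zE].
    apply: (wmax (ann (x * w))); first by exists (x * w).
      by move=> d /asboolP[z' z'E]; apply/asboolP; exists (x * z'); rewrite mulrCA z'E mulrCA.
    by apply/asboolP; exists z; rewrite mulrA.
  have [i [d [c E]]] := pigeonhole_mod repP (fun m => x ^+ m).
  have : 1 - x ^+ d.+1 \in ann w.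
    apply: (annX i); apply/asboolP; exists (- c * w); rewrite mulrA mulrBl mul1r -exprD addnC E.
    ring.
  move=> /wP H; have := idealr1 P.
  by rewrite -[1](subrK (x ^+ d.+1)) rpredD // exprSr idealMr.
apply: (wmax (ann (c * w))).
- exists (c * w); split=> // d /asboolP[z zE].
  have : d * c \in P by apply: wP; apply/asboolP; exists z; rewrite -zE mulrA.
  by rewrite prime_idealrM => /orP[//|cP']; case: cP.
- by move=> d /asboolP[z zE]; apply/asboolP; exists (c * z); rewrite mulrCA zE mulrCA.
by move/asboolP: cxw => [z zE]; apply/asboolP; exists z; rewrite -zE; ring.
Qed.

(* Multiplication by g = b/p maps P into A; if it mapped P into itself, all p g^k
   would lie in A, and since A/pA is finite g would be integral. *)
Lemma uniformizer P : p%:R \in P ->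
  exists b : A, (forall x, x \in P -> exists c, b * x = p%:R * c) /\
    exists y c, [/\ y \in P, c \notin P & b * y = p%:R * c].
Proof.
move=> pP; have [n [rep repP]] := int_quot_finite K p_pr.
have [b [bn bP]] := associated_prime pP; exists b; split=> //.
apply: contrapT => H.
have /choice[F FP] : forall x, exists c, x \in P -> b * x = p%:R * c /\ c \in P.
  move=> x; have [xP|nP] := boolP (x \in P); last by exists 0.
  have [c cE] := bP x xP; exists c => _; split=> //.
  by apply/negPn/negP => cP; apply: H; exists x, c.
pose u m := iter m F p%:R.
have uP m : u m \in P by elim: m => //= m IH; case: (FP _ IH).
have uS m : b * u m = p%:R * u m.+1 by case: (FP _ (uP m)).
have p0 : (p%:R : K) != 0.
  have := int_eq0 K p; rewrite -(inj_eq val_inj) rmorph0 rmorph_int -pmulrn => ->.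
  by rewrite eqz_nat -lt0n prime_gt0.
pose g : K := (b : K) / p%:R.
have bE : (b : K) = g * p%:R by rewrite /g divfK.
have uE m : (u m : K) = g ^+ m * p%:R.
  elim: m => [|m IH]; first by rewrite expr0 mul1r; exact: (rmorph_nat (val : A -> K)).
  have := congr1 val (uS m); rewrite !rmorphM rmorph_nat /= IH bE => E.
  by apply: (mulfI p0); rewrite -E exprS; ring.
have [i [d [c E]]] := pigeonhole_mod repP u.
(* Dividing the pigeonhole relation by p leaves a monic equation for g with coefficients in A. *)
have gE : g ^+ (i + d.+1) = g ^+ i + (c : K).
  have := congr1 val E; rewrite rmorphD rmorphM rmorph_nat /= !uE => E'.
  by apply: (mulIf p0); rewrite E'; ring.
have gA : g \in @int_pred K.
  apply/asboolP; pose q : {poly K} := 'X^(i + d.+1) - ('X^i + (c : K)%:P).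
  have szq : (size ('X^i + (c : K)%:P)%R < size ('X^(i + d.+1) : {poly K})%R)%N.
    rewrite size_polyXn (leq_ltn_trans (size_polyD _ _)) // gtn_max size_polyXn.
    rewrite ltnS addnS ltnS leq_addr (leq_ltn_trans (size_polyC_leq1 _)) //.
  have qm : q \is monic.
    by rewrite monicE /q lead_coefDl ?size_polyN // lead_coefXn.
  apply: (integral_root_monic qm).
    by rewrite rootE /q !hornerE gE subrr.
  have intA (x : A) : integralOver (intr : int -> K) (x : K) by case: x => x /= /asboolP.
  apply/integral_poly => j.
  have int01 (t : bool) : integralOver (intr : int -> K) (t%:R : K).
    by case: t; [exact: integral1 | exact: integral0].
  rewrite /q coefB coefD !coefXn coefC; apply: integral_sub => //.
  by apply: integral_add => //; case: eqP => _; [exact: intA|exact: integral0].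
apply: (bn (RingInt gA)); apply: val_inj.
by rewrite rmorphM rmorph_nat /= bE mulrC.
Qed.

(** Presents A/P as a [finFieldType], with inverses from [prime_inverse], so that residual degrees
    are read off cardinalities. *)
Lemma residue_field P : p%:R \in P ->
  exists (F : finFieldType) (h : {rmorphism A -> F}),
    [/\ forall y, exists x, h x = y, forall x, (h x == 0) = (x \in P), p \in [pchar F]
      & forall f, residual_degree P p f <-> #|F| = (p ^ f)%N].
Proof.
move=> pP; have [n [rep repP]] := int_quot_finite K p_pr.
pose Q := {ideal_quot P}; pose h0 : {rmorphism A -> Q} := \pi_Q.
have h00 x : (h0 x == 0) = (x \in P).
  by rewrite -(rmorph0 h0) -Quotient.idealrBE subr0.
have h0_onto (y : Q) : exists x, h0 x = y by exists (generic_quotient.repr y); rewrite /h0 /= reprK.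
have repK : exists g : Q -> 'I_n, cancel g (fun i => h0 (rep i)).
  suff /choice[g gP] : forall y : Q, exists i, h0 (rep i) = y by exists g.
  move=> y; have [x <-] := h0_onto y; have [i [c ->]] := repP x; exists i.
  have /eqP pc : h0 (p%:R * c) == 0 by rewrite h00 mulrC idealMr.
  by rewrite rmorphD pc addr0.
have [g gK] := repK.
have invP : exists inv : Q -> Q, (forall y, y != 0 -> inv y * y = 1) /\ inv 0 = 0.
  suff /choice[inv iP] : forall y : Q, exists z, (y != 0 -> z * y = 1) /\ (y = 0 -> z = 0).
    by exists inv; split=> [y|]; [case: (iP y) | exact: (iP 0).2].
  move=> y; have [->|y0] := eqVneq y 0; first by exists 0.
  have [x xE] := h0_onto y; have [|z zP] := prime_inverse repP pP (x := x).
    by rewrite -h00 xE.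
  exists (h0 z); split=> [_|/eqP]; last by rewrite (negbTE y0).
  by move: zP; rewrite -h00 rmorphB rmorphM rmorph1 xE subr_eq0 mulrC => /eqP.
have [inv [invV inv0]] := invP.
pose cM := CanIsCountable gK.
pose cQ : countType := HB.pack Q cM.
pose fM := @CanIsFinite cQ _ _ _ gK.
pose uM := GRing.ComNzRing_isField.Build Q invV inv0.
pose F : finFieldType := HB.pack Q cM fM uM.
have charF : p \in [pchar F].
  by rewrite inE p_pr /=; have := h00 p%:R; rewrite pP rmorph_nat.
exists F, (h0 : {rmorphism A -> F}); split=> // f; split.
  move=> [charP [[v lin_v bij_v]]].
  have := @bij_eq_card F _ v bij_v.
  by rewrite card_mx mul1n card_Fp.
move=> cF; have charP : p \in [pchar {ideal_quot P}] := charF.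
exists charP; constructor.
have := @pprimeChar_vectAxiom p F charF; rewrite cF pfactorK //.
Qed.

End PrimesAboveP.

(** * Generic lifts and subrings of ramified type *)

Section GenericElements.
Variables (K : fieldExtType rat) (p : nat) (p_pr : prime p).
Local Notation A := (ring_int K).
Variables (t : nat) (P : 'I_t -> prime_idealr A).
Hypothesis pP : forall i, p%:R \in P i.
Hypothesis P_inj : forall i j, P i =i P j -> i = j.
Hypothesis P_all : forall Q : prime_idealr A, p%:R \in Q -> exists i, Q =i P i.
Implicit Types (S : {pred A}) (a x y : A).

Definition onto_residues S := forall a, exists2 s, s \in S & forall i, a - s \in P i.

(** For x in [P i] one gets c x = h (b x / p) with c outside [P i]: locally at [P i], h divides
    every element of [P i]. *)
Definition divides_at i (h : A) := exists b c, [/\ forall x, x \in P i -> exists z, b * x = p%:R * z,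
  c \notin P i & b * h = p%:R * c].

(* Locally at each P_i, h or p generates P_i, so the radical of pA is Ah + pA and A = S + Ah;
   iterating, A = S + Ah^m for all m, and h is nilpotent mod p. *)
Lemma radical_generator_full S h : is_subring S -> (forall a, p%:R * a \in S) ->
  onto_residues S -> h \in S -> (forall i, h \in P i) ->
  (forall i, divides_at i h \/ divides_at i p%:R) -> forall a, a \in S.
Proof.
move=> [[S0 SB] SM] pS ontoS hS hP hdiv; have [n [rep repP]] := int_quot_finite K p_pr.
have SD x y : x \in S -> y \in S -> x + y \in S.
  by move=> xS yS; rewrite -[y]opprK -[- y]add0r !SB.
have radh x : (forall i, x \in P i) -> exists u v, x = u * h + p%:R * v.
  (* [I] collects the multipliers sending x into Ah + pA. It contains the c of [divides_at], which
     lies outside [P i], so no prime over p contains [I]. *)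
  move=> xP; pose I : {pred A} := fun c => `[< exists u v, c * x = u * h + p%:R * v >].
  have iI : ideal_above p I.
    split=> [y z /asboolP[u [v uv]] /asboolP[u' [v' uv']]|a y /asboolP[u [v uv]]|a]; apply/asboolP.
    - by exists (u + u'), (v + v'); rewrite mulrDl uv uv'; ring.
    - by exists (a * u), (a * v); rewrite -mulrA uv; ring.
    - by exists 0, (a * x); ring.
  have [/asboolP[u [v]]|nI] := boolP (1 \in I); first by rewrite mul1r => ->; exists u, v.
  have [Q [IQ pQ]] := prime_ideal_above repP iI nI; have [i Qi] := P_all pQ.
  suff [w [b [c [wE bP cP bw]]]] : exists w b c, [/\ w = h \/ w = p%:R,
      forall x, x \in P i -> exists z, b * x = p%:R * z, c \notin P i & b * w = p%:R * c].
    have [z zE] := bP x (xP i).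
    have cxE : c * x = w * z.
      apply: (nat_mulI (prime_gt0 p_pr)); transitivity (b * w * x).
        by rewrite bw; ring.
      by rewrite mulrAC zE; ring.
    have : c \in I.
      apply/asboolP; case: wE => wE; first by exists z, 0; rewrite cxE wE; ring.
      by exists 0, z; rewrite cxE wE; ring.
    by move=> /IQ; rewrite Qi (negbTE cP).
  have [[b [c [bP cP bh]]]|[b [c [bP cP bh]]]] := hdiv i.
    by exists h, b, c; split=> //; left.
  by exists p%:R, b, c; split=> //; right.
have stepS x : exists2 s, s \in S & exists u, x = s + u * h.
  have [s sS sP] := ontoS x; have [u [v uv]] := radh _ sP.
  exists (s + p%:R * v); first exact: SD.
  by exists u; rewrite -[x](subrK s) uv; ring.
have hX m : forall s, s \in S -> s * h ^+ m \in S.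
  elim: m => [|m IH] s sS; first by rewrite mulr1.
  by rewrite exprS mulrA IH // SM.
have [m [c hm]] := radical_nilpotent repP (h := h) (fun Q pQ => let: ex_intro i Qi := P_all pQ in
  etrans (Qi h) (hP i)).
move=> a; suff [s sS [u ->]] : exists2 s, s \in S & exists u, a = s + u * h ^+ m.
  by rewrite hm mulrCA SD.
elim: m {c hm} => [|m [s sS [u ->]]]; first by exists 0 => //; exists a; rewrite mulr1 add0r.
have [s' s'S [u' ->]] := stepS u; exists (s + s' * h ^+ m); first by rewrite SD ?hX.
by exists u'; rewrite exprS; ring.
Qed.

(** Local generators of the single primes are glued by approximate idempotents. These are squared:
    for j different from i, one factor [e j] makes [b i * e j] divisible by p, the other keeps the
    quotient in [P i]. *)
Lemma radical_uniformizer : exists b : 'I_t -> A, exists u : A,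
  [/\ forall i x, x \in P i -> exists z, b i * x = p%:R * z, forall i, u \in P i
    & forall i, exists2 g, b i * u = p%:R * g & g \notin P i].
Proof.
have /fin_all_exists[b bP] i := uniformizer p_pr (pP i).
have /fin_all_exists[y /fin_all_exists[c ycP]] i := (bP i).2.
have [n [rep repP]] := int_quot_finite K p_pr.
have /fin_all_exists[e eP] i := prime_idempotent repP pP P_inj i.
have eN i : e i \notin P i.
  apply/negP => eiP; have := idealr1 (P i).
  by rewrite -[1](subKr (e i)) rpredB //; case: (eP i).
exists b, (\sum_j e j ^+ 2 * y j); split=> [i|i|i]; first exact: (bP i).1.
  apply: rpred_sum => j _; have [->|ji] := eqVneq j i.
    by rewrite idealMr //; case: (ycP i).
  by rewrite mulrC idealMr // expr2 idealMr //; apply: (eP j).2; rewrite eq_sym.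
have [yP cP byc] := ycP i.
have /fin_all_exists[z zP] j : exists z, j != i -> b i * e j = p%:R * z.
  have [->|ji] := eqVneq j i; first by exists 0.
  have [|z zE] := (bP i).1 (e j); first by apply: (eP j).2; rewrite eq_sym.
  by exists z.
exists (e i ^+ 2 * c i + \sum_(j | j != i) z j * e j * y j).
  rewrite (bigD1 i) //= !mulrDr; congr (_ + _).
    by rewrite mulrCA byc mulrCA.
  rewrite !mulr_sumr; apply: eq_bigr => j ji.
  by rewrite expr2 !mulrA zP // -!mulrA.
rewrite rpredDr; last first.
  apply: rpred_sum => j ji; rewrite mulrC idealMr // idealMr //.
  by apply: (eP j).2; rewrite eq_sym.
by rewrite !prime_idealrM !negb_or eN cP.
Qed.

Lemma residue_exponent : exists2 e, (0 < e)%N & forall i x, x ^+ (p ^ e) - x \in P i.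
Proof.
have H i : exists f, (0 < f)%N /\ forall m x, x ^+ (p ^ (f * m)) - x \in P i.
  have [F [h [_ hP charF hf]]] := residue_field p_pr (pP i).
  exists (logn p #|F|); have cF := card_pprimeChar charF; split.
    have : (1 < p ^ logn p #|F|)%N by rewrite -cF finNzRing_gt1.
    by case: (logn _ _).
  move=> m x; rewrite -hP rmorphB rmorphXn expnM -cF subr_eq0.
  elim: m => [|m /eqP IH]; first by rewrite expn0.
  by rewrite expnS exprM expf_card IH.
have /fin_all_exists[f fP] := H.
exists (\prod_i f i)%N; first by rewrite prodn_gt0 // => i; case: (fP i).
by move=> i x; rewrite (bigD1 i) //=; case: (fP i).
Qed.

(* The subrings surjecting onto all the residue products are those coming from ramified primes;
   a^q - a, with q = p^e killing the residues, is made a local generator at every such prime. *)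
Lemma generic_element a0 : exists a, (forall i, a - a0 \in P i) /\
  forall S, is_subring S -> (forall x, p%:R * x \in S) -> a \in S -> onto_residues S ->
  forall x, x \in S.
Proof.
have [b [u [bP uP ug]]] := radical_uniformizer; have [e e0 eP] := residue_exponent.
set q := (p ^ e)%N in eP; have q_gt1 : (1 < q)%N.
  by rewrite -(expn0 p) ltn_exp2l // prime_gt1.
have /fin_all_exists2[g ugE gN] := ug.
have /fin_all_exists[d dE] i : exists d, b i * (a0 ^+ q - a0) = p%:R * d.
  exact: (bP i _ (eP i a0)).
have [n [rep repP]] := int_quot_finite K p_pr.
(* w is 1 or 0 modulo [P i] so that [d i - w * g i] lies outside [P i] in both cases; when [b i] is
   in [P i], this is b_i (a^q - a) / p modulo [P i]. *)
have [w wP] := residues_onto repP pP P_inj (fun i => if d i \in P i then 1 else 0).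
exists (a0 + w * u); split=> [i|S sS pS aS ontoS].
  by rewrite addrC addKr; apply: idealMr; exact: uP.
have [[S0 SB] SM] := sS.
set a := a0 + w * u in aS; pose h := a ^+ q - a.
have hS : h \in S.
  apply: SB => //; rewrite -(prednK (ltnW q_gt1)).
  by elim: (q.-1) => [|m IH]; rewrite ?expr1 // exprS SM.
apply: (radical_generator_full sS pS ontoS hS) => [i|i]; first exact: eP.
(* If [b i] is outside [P i], the prime is unramified and p itself is a local generator. *)
have [biP|biN] := boolP (b i \in P i); last first.
  by right; exists (b i), (b i); split=> //; [exact: bP | rewrite mulrC].
left; have [v vE] := exprD_mod_prime_pow e a0 (w * u) p_pr.
pose c := d i + w * g i * ((w * u) ^+ q.-1) - w * g i + b i * v.
exists (b i), c; split; first exact: bP.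
  have -> : c = (d i - w * g i) + (w * g i * ((w * u) ^+ q.-1) + b i * v) by rewrite /c; ring.
  rewrite rpredDr; last first.
    rewrite rpredD //; last by rewrite mulrC idealMr.
    rewrite idealMr // -(prednK (n := q.-1)) ?exprS; last by rewrite -ltnS prednK ?(ltnW q_gt1).
    by rewrite mulrC; do 2 apply: idealMr; exact: uP.
  have := wP i; case: (boolP (d i \in P i)) => diP; rewrite ?subr0 => wi.
    rewrite rpredBl // prime_idealrM negb_or gN andbT.
    by apply/negP => wi'; have := idealr1 (P i); rewrite -[1](subKr w) rpredB.
  by rewrite rpredBr // mulrC idealMr.
have -> : h = (a0 ^+ q - a0) + w * u * (w * u) ^+ q.-1 + p%:R * v - w * u.
  by rewrite -exprS (prednK (ltnW q_gt1)) /h /a /q vE; ring.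
transitivity (b i * (a0 ^+ q - a0) + b i * u * (w * (w * u) ^+ q.-1) +
    p%:R * (b i * v) - w * (b i * u)); first by ring.
by rewrite dE ugE /c; ring.
Qed.

End GenericElements.

(** * Reduction of a finite cover to one prime *)

Section FiniteIndex.
Variable U : zmodType.
Implicit Type H : {pred U}.

Definition finite_index H := exists s : seq U, forall x, exists2 y, y \in s & x - y \in H.

(* B.H. Neumann: if some coset a + H_j escapes the cosets of H_j that occur in the cover, it is
   covered by the cosets of the other subgroups, and so are all cosets of H_j by translation. *)
Lemma coset_cover_finite_index (T : eqType) (H : T -> {pred U}) (js : seq T) (L : seq (U * T)) :
  (forall j, GRing.zmod_closed (H j)) -> (forall l, l \in L -> l.2 \in js) ->
  (forall x, exists2 l, l \in L & x - l.1 \in H l.2) ->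
  exists2 j, j \in js & finite_index (H j).
Proof.
move=> zH; elim: js L => [|j js IH] L Ljs Lcov.
  by have [l /Ljs] := Lcov 0.
have [full|/existsNP[a aP]] :=
    pselect (forall x, exists2 l, (l \in L) && (l.2 == j) & x - l.1 \in H j).
  exists j; first exact: mem_head.
  exists [seq l.1 | l <- L & l.2 == j] => x; have [l /andP[lL lj] xl] := full x.
  by exists l.1 => //; apply: map_f; rewrite mem_filter lj.
have aN l : l \in L -> l.2 = j -> a - l.1 \notin H j.
  by move=> lL lj; apply/negP => al; apply: aP; exists l; rewrite // lL lj eqxx.
have zj (x y : U) : x \in H j -> y \in H j -> x - y \in H j by case: (zH j) => _; exact.
pose L1 := [seq l <- L | l.2 != j]; pose L0 := [seq l <- L | l.2 == j].
pose L' := L1 ++ [seq (l.1 - a + l'.1, l'.2) | l <- L0, l' <- L1].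
have L1js l : l \in L1 -> l.2 \in js.
  by rewrite mem_filter => /andP[lj /Ljs]; rewrite inE (negbTE lj).
have [||i ijs fi] := IH L'.
- move=> l; rewrite mem_cat => /orP[/L1js//|/allpairsP[[l0 l1] /= [_ l1L ->]]] /=.
  exact: L1js.
- move=> x; have [l lL xl] := Lcov x.
  have [lj|lj] := eqVneq l.2 j; last by exists l; rewrite // mem_cat mem_filter lj lL.
  have [l' l'L al'] := Lcov (a + (x - l.1)).
  have l'j : l'.2 != j.
    apply/eqP => l'j; have := aN _ l'L l'j; rewrite -l'j.
    have -> : a - l'.1 = (a + (x - l.1) - l'.1) - (x - l.1).
      by rewrite [a + _ - _]addrAC addrK.
    by rewrite {1}l'j zj // -?l'j // l'j -lj.
  exists (l.1 - a + l'.1, l'.2); last first.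
    by rewrite /= opprD opprB addrA [x + _]addrCA.
  rewrite mem_cat; apply/orP; right; apply/allpairsP; exists (l, l') => /=.
  by split=> //; rewrite mem_filter ?lj ?eqxx ?l'j.
by exists i; rewrite // inE ijs orbT.
Qed.

(** Two of the multiples 0, x, ..., (size s) x lie in the same coset, so d x is in [H] for some 0 <
    d <= size s, and d divides the factorial. *)
Lemma finite_index_mul H : GRing.zmod_closed H -> finite_index H ->
  exists2 m, (0 < m)%N & forall x, x *+ m \in H.
Proof.
move=> [H0 HB] [s sP]; have HM x m : x \in H -> x *+ m \in H.
  move=> xH; elim: m => // m IH; rewrite mulrS -[x *+ m]opprK HB //.
  by rewrite -[- _]add0r HB.
exists (size s)`!; first exact: fact_gt0.
move=> x; have /choice[h hP] : forall m, exists y, y \in s /\ x *+ m - y \in H.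
  by move=> m; have [y ys yH] := sP (x *+ m); exists y.
pose g (i : 'I_(size s).+1) := h i.
have /injectivePn[i [j ij hij]] : ~~ injectiveb g.
  apply/negP => /injectiveP g_inj.
  have : (size [seq g i | i <- enum 'I_(size s).+1] <= size s)%N.
    apply: uniq_leq_size; first by rewrite map_inj_uniq ?enum_uniq.
    by move=> _ /mapP[i _ ->]; case: (hP i).
  by rewrite size_map size_enum_ord ltnn.
wlog lt_ij : i j ij hij / (i < j)%N.
  move=> W; have [|ji|/val_inj e] := ltngtP i j; first exact: (W i j).
    by apply: (W j i) => //; rewrite eq_sym.
  by rewrite e eqxx in ij.
have xH : x *+ (j - i) \in H.
  rewrite mulrnBr 1?ltnW //.
  have -> : x *+ j - x *+ i = (x *+ j - g j) - (x *+ i - g i) by rewrite hij opprB addrA addrNK.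
  by rewrite HB //; [case: (hP j)|case: (hP i)].
have /dvdnP[m ->] : (j - i %| (size s)`!)%N.
  rewrite dvdn_fact // subn_gt0 lt_ij /=.
  by rewrite (leq_trans (leq_subr _ _)) // -ltnS.
by rewrite mulnC mulrnA HM.
Qed.

End FiniteIndex.

Section CoverReduction.
Variable K : fieldExtType rat.
Local Notation A := (ring_int K).

Lemma int_quot_finite_mul m : (0 < m)%N ->
  exists s : seq A, forall x, exists2 r, r \in s & exists c, x = r + m%:R * c.
Proof.
elim/ltn_ind: m => m IH m_gt0; have [m1|m1] := leqP m 1.
  have -> : m = 1%N by apply/anti_leq; rewrite m1.
  by exists [:: 0] => x; exists 0; [rewrite mem_head | exists x; rewrite mul1r add0r].
have p_pr := pdiv_prime m1; set p := pdiv m in p_pr.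
have /dvdnP[m' mE] : (p %| m)%N by exact: pdiv_dvd.
have m'0 : (0 < m')%N by move: m_gt0; rewrite mE muln_gt0 => /andP[].
have [|//|s sP] := IH m'; first by rewrite [ltnRHS]mE ltn_Pmulr // prime_gt1.
have [n [rep repP]] := int_quot_finite K p_pr.
exists [seq r + m'%:R * rep i | r <- s, i <- enum 'I_n] => x.
have [r rs [c ->]] := sP x; have [i [d ->]] := repP c.
exists (r + m'%:R * rep i); first by apply/allpairsP; exists (r, i); rewrite mem_enum.
by exists d; rewrite mE natrM; ring.
Qed.

(** If a lies in no member of finite index, choose M with MA inside all those members: they miss a +
    MA altogether. The others then cover it, and finitely many translates of them cover A, against
    Neumann's lemma. *)
Lemma cover_finite_index n (S : 'I_n -> {pred A}) :
  (forall i, GRing.zmod_closed (S i)) -> (forall x, exists i, x \in S i) ->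
  forall x, exists2 i, finite_index (S i) & x \in S i.
Proof.
move=> zS Scov a; apply: contrapT => aN.
have /fin_all_exists[m mP] i : exists m, (0 < m)%N /\
    (finite_index (S i) -> forall x, m%:R * x \in S i).
  have [fi|nfi] := pselect (finite_index (S i)); last by exists 1%N.
  have [m m0 mS] := finite_index_mul (zS i) fi.
  by exists m; split=> // _ x; rewrite mulr_natl.
pose M := (\prod_i m i)%N.
have MS i x : finite_index (S i) -> M%:R * x \in S i.
  move=> fi; rewrite /M (bigD1 i) //= natrM -mulrA; exact: (mP i).2.
have [|s sP] := @int_quot_finite_mul M; first by rewrite prodn_gt0 // => i; case: (mP i).
pose js := [seq i <- enum 'I_n | ~~ `[< finite_index (S i) >]].
have [||i] := @coset_cover_finite_index _ _ S js [seq (r - a, i) | r <- s, i <- js] zS.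
- by move=> l /allpairsP[[r i] /= [_ ijs ->]].
- move=> x; have [r rs [c ->]] := sP x; have [i iS] := Scov (a + M%:R * c).
  exists (r - a, i); last first.
    by have -> : r + M%:R * c - (r - a) = a + M%:R * c by ring.
  apply/allpairsP; exists (r, i); split=> //; rewrite mem_filter mem_enum andbT.
  apply/asboolP => fi; apply: aN; exists i => //.
  by have [_ SB] := zS i; rewrite -[a](addrK (M%:R * c)) SB // MS.
by rewrite mem_filter => /andP[/asboolP].
Qed.

(** If S + pA = A for all primes p, then S + dA = A for every d > 0, one prime factor at a time; d =
    m gives S = A. *)
Lemma proper_mod_prime (S : {pred A}) m : GRing.zmod_closed S -> (0 < m)%N ->
  (forall x, m%:R * x \in S) -> (exists x, x \notin S) ->
  exists2 p, prime p & exists x, forall s c, s \in S -> x <> s + p%:R * c.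
Proof.
move=> [S0 SB] m0 mS [x0 x0S]; apply: contrapT => H.
have SD x y : x \in S -> y \in S -> x + y \in S.
  by move=> xS yS; rewrite -[y]opprK -[- y]add0r !SB.
have SM x d : x \in S -> d%:R * x \in S.
  by move=> xS; elim: d => [|d IH]; rewrite ?mul0r // -natr1 mulrDl mul1r SD.
have full p : prime p -> forall x, exists s c, s \in S /\ x = s + p%:R * c.
  move=> p_pr x; apply: contrapT => xN; apply: H; exists p => //; exists x => s c sS xE.
  by apply: xN; exists s, c.
have {}full d : (0 < d)%N -> forall x, exists s c, s \in S /\ x = s + d%:R * c.
  elim/ltn_ind: d => d IH d_gt0; have [d1|d1] := leqP d 1.
    have -> : d = 1%N by apply/anti_leq; rewrite d1.
    by move=> x; exists 0, x; rewrite mul1r add0r.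
  have p_pr := pdiv_prime d1; set p := pdiv d in p_pr.
  have /dvdnP[d' dE] : (p %| d)%N by exact: pdiv_dvd.
  have d'0 : (0 < d')%N by move: d_gt0; rewrite dE muln_gt0 => /andP[].
  have {}IH : forall x, exists s c, s \in S /\ x = s + d'%:R * c.
    by apply: IH => //; rewrite [ltnRHS]dE ltn_Pmulr // prime_gt1.
  move=> x; have [s [c [sS ->]]] := IH x; have [s' [c' [s'S ->]]] := full p p_pr c.
  exists (s + d'%:R * s'), c'; rewrite SD ?SM //; split=> //.
  by rewrite dE natrM; ring.
have [s [c [sS xE]]] := full m m0 x0.
by move/negP: x0S; apply; rewrite xE SD.
Qed.

Lemma chinese_mod_primes (ps : seq nat) (a : nat -> A) : uniq ps -> all prime ps ->
  exists x, forall p, p \in ps -> exists c, x = a p + p%:R * c.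
Proof.
elim: ps => [|p ps IH] /=; first by exists 0.
move=> /andP[pps ups] /andP[p_pr ps_pr]; have [x xP] := IH ups ps_pr.
pose M := (\prod_(q <- ps) q)%N.
have cop : coprime p M.
  rewrite /M; elim: ps pps ps_pr {IH ups xP M} => [|q ps IH] /=; first by rewrite big_nil coprimen1.
  rewrite inE negb_or => /andP[pq pps] /andP[q_pr ps_pr].
  rewrite big_cons coprimeMr IH // andbT prime_coprime //.
  by rewrite dvdn_prime2.
have [[u v] /= uv] := coprimezP p M cop.
have uvA : u%:~R * p%:R + v%:~R * M%:R = 1 :> A.
  by have := congr1 (fun z : int => z%:~R : A) uv; rewrite rmorphD !rmorphM /= -!pmulrn.
exists (x + v%:~R * M%:R * (a p - x)) => q; rewrite inE => /orP[/eqP->|qps].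
  exists (u%:~R * (x - a p)); apply/eqP; rewrite -subr_eq0.
  have -> : x + v%:~R * M%:R * (a p - x) - (a p + p%:R * (u%:~R * (x - a p))) =
    (x - a p) * (1 - (u%:~R * p%:R + v%:~R * M%:R)) by ring.
  by rewrite uvA subrr mulr0.
have [c xE] := xP q qps.
have /dvdnP[d ME] : (q %| M)%N by rewrite /M (big_rem q) //= dvdn_mulr.
exists (c + v%:~R * d%:R * (a p - x)); rewrite ME natrM {1}xE; ring.
Qed.

(** [Y] marks the members in use: some of the n subrings are dropped, while the index set and hence
    the count n stay. *)
Definition prime_cover p n (S : 'I_n -> {pred A}) (Y : {set 'I_n}) : Prop :=
  (forall i, i \in Y -> [/\ is_subring (S i), forall x, p%:R * x \in S i & exists x, x \notin S i])
  /\ forall x, exists2 i, i \in Y & x \in S i.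

Lemma cover_mod_prime n : covered_by A n ->
  exists2 p, prime p & exists (S : 'I_n -> {pred A}) (Y : {set 'I_n}), prime_cover p S Y.
Proof.
move=> [S [Sproper Scov]].
have zS i : GRing.zmod_closed (S i) by case: (Sproper i) => -[].
have Sfin := cover_finite_index zS Scov.
have /fin_all_exists[p pP] i : exists p, prime p /\ (finite_index (S i) ->
    exists x, forall s c, s \in S i -> x <> s + p%:R * c).
  (* 2 is a placeholder; members of infinite index enter no [Y q]. *)
  have [fi|nfi] := pselect (finite_index (S i)); last by exists 2%N.
  have [m m0 mS] := finite_index_mul (zS i) fi.
  have [p p_pr px] := proper_mod_prime (zS i) m0 (fun x => etrans (congr1 (fun z => z \in S i)
    (mulr_natl x m)) (mS x)) (Sproper i).2.
  by exists p.
pose S' i : {pred A} := fun x => `[< exists s c, s \in S i /\ x = s + (p i)%:R * c >].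
have SS' i x : x \in S i -> x \in S' i.
  by move=> xS; apply/asboolP; exists x, 0; rewrite mulr0 addr0.
pose Y q := [set i | `[< finite_index (S i) >] && (p i == q)].
suff [q [q_pr qcov]] : exists q, prime q /\ forall x, exists2 i, i \in Y q & x \in S' i.
  exists q => //; exists S', (Y q); split=> // i; rewrite inE => /andP[/asboolP fi /eqP piq].
  have [_ /(_ fi)[x0 x0P]] := pP i; have [[[S0 SB] SM] _] := Sproper i.
  split; last first.
  - by exists x0; apply/asboolP => -[s [c [sS xE]]]; exact: (x0P s c).
  - by move=> x; rewrite -piq; apply/asboolP; exists 0, x; rewrite add0r.
  split; first split.
  - exact: SS'.
  - move=> _ _ /asboolP[s [c [sS ->]]] /asboolP[s' [c' [s'S ->]]]; apply/asboolP.
    by exists (s - s'), (c - c'); split; [exact: SB | ring].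
  - move=> _ _ /asboolP[s [c [sS ->]]] /asboolP[s' [c' [s'S ->]]]; apply/asboolP.
    exists (s * s'), (s * c' + c * s' + (p i)%:R * c * c'); split; [exact: SM | ring].
apply: contrapT => H.
(* If for each prime q the enlarged subrings miss some [a q], an x congruent to [a q] modulo every
   prime that occurs lies in no member of finite index. *)
have /choice[a aP] : forall q, exists x, prime q -> forall i, i \in Y q -> x \notin S' i.
  move=> q; have [q_pr|nq] := pselect (prime q); last by exists 0.
  apply: contrapT => H'; apply: H; exists q; split=> // x; apply: contrapT => xN.
  by apply: H'; exists x => _ i iY; apply/negP => xS; apply: xN; exists i.
have [||x xP] := @chinese_mod_primes (undup [seq p i | i <- enum 'I_n]) a.
- exact: undup_uniq.
- by apply/allP => q; rewrite mem_undup => /mapP[i _ ->]; case: (pP i).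
have [i fi xS] := Sfin x; have [|c xE] := xP (p i).
  by rewrite mem_undup map_f // mem_enum.
have iY : i \in Y (p i) by rewrite inE eqxx andbT; apply/asboolP.
move/negP: (aP (p i) (pP i).1 i iY); apply.
by apply/asboolP; exists x, (- c); split=> //; rewrite xE; ring.
Qed.

End CoverReduction.

(** * Goursat's lemma for two residue fields *)

Section Goursat.
Variables (R : comNzRingType) (k1 k2 : finFieldType).
Variables (h1 : {rmorphism R -> k1}) (h2 : {rmorphism R -> k2}) (S : {pred R}).
Hypothesis S_add : forall x y, x \in S -> y \in S -> x + y \in S.
Hypothesis S_mul : forall x y, x \in S -> y \in S -> x * y \in S.
Hypothesis onto1 : forall y, exists2 s, s \in S & h1 s = y.
Hypothesis onto2 : forall y, exists2 s, s \in S & h2 s = y.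
Hypothesis not_onto : ~ forall a, exists2 s, s \in S & h1 s = h1 a /\ h2 s = h2 a.

(** An s in [S] with h1 s = 0 and h2 s nonzero would let the second coordinate be corrected freely
    without moving the first. *)
Lemma Goursat_ker s : s \in S -> h1 s = 0 -> h2 s = 0.
Proof.
move=> sS s1; apply: contrapT => /eqP s2; apply: not_onto => a.
have [r rS ra] := onto1 (h1 a); have [d dS da] := onto2 ((h2 a - h2 r) / h2 s).
exists (r + s * d); first by rewrite S_add ?S_mul.
by rewrite !rmorphD !rmorphM s1 mul0r addr0 da mulrCA divff // mulr1 addrC subrK.
Qed.

End Goursat.

Lemma Goursat_card (R : comNzRingType) (k1 k2 : finFieldType)
  (h1 : {rmorphism R -> k1}) (h2 : {rmorphism R -> k2}) (S : {pred R}) :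
  (forall x y, x \in S -> y \in S -> x - y \in S) ->
  (forall y, exists2 s, s \in S & h2 s = y) ->
  (forall s, s \in S -> h1 s = 0 -> h2 s = 0) -> (#|k2| <= #|k1|)%N.
Proof.
move=> SB onto2 ker.
have /fin_all_exists[r rP] : forall y : k2, exists s, s \in S /\ h2 s = y.
  by move=> y; have [s sS sy] := onto2 y; exists s.
apply: (@leq_card _ _ (fun y => h1 (r y))) => y z yz.
have [[ryS ryE] [rzS rzE]] := (rP y, rP z).
apply/eqP; rewrite -ryE -rzE -subr_eq0 -rmorphB; apply/eqP/ker; first exact: SB.
by rewrite rmorphB yz subrr.
Qed.

(** * The lower bound for covers modulo one prime number *)

Section PrimeCoverBound.
Variables (K : fieldExtType rat) (p : nat) (p_pr : prime p).
Local Notation A := (ring_int K).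
Variables (t : nat) (P : 'I_t -> prime_idealr A).
Hypothesis pP : forall i, p%:R \in P i.
Hypothesis P_inj : forall i j, P i =i P j -> i = j.
Hypothesis P_all : forall Q : prime_idealr A, p%:R \in Q -> exists i, Q =i P i.

(** For every pair of primes [S] holds an element that is 1 at one and 0 at the other; products of
    these are approximate idempotents inside [S]. Hence obstructions involve no more than two
    primes. *)
Lemma pairwise_onto_residues (S : {pred A}) : is_subring S ->
  (forall v a, exists2 s, s \in S & a - s \in P v) ->
  (forall u v, u != v -> forall a, exists2 s, s \in S & a - s \in P u /\ a - s \in P v) ->
  onto_residues P S.
Proof.
move=> [[S0 SB] SM] onto1 onto2 a; have [n [rep repP]] := int_quot_finite K p_pr.
have eH v j : exists s : A, s \in S /\ (j != v -> 1 - s \in P v /\ s \in P j).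
  have [->|jv] := eqVneq j v; first by exists 0.
  have [x [xv xN]] := prime_idempotent repP pP P_inj v.
  have [s sS [sj sv]] := onto2 _ _ jv x; exists s; split=> // _; split.
    have -> : 1 - s = (x - s) - (x - 1) by ring.
    by apply: rpredB.
  by rewrite -[s](subKr x); apply: rpredB => //; exact: xN.
have /fin_all_exists[e eP] v := fin_all_exists (eH v).
have /fin_all_exists2[r rS rP] v := onto1 v a.
pose z v := (\prod_(j | j != v) e v j) * r v.
have zS v : z v \in S.
  rewrite /z; elim/big_rec: _ => [|j y _ yS]; first by rewrite mul1r.
  by rewrite -mulrA SM //; case: (eP v j).
exists (\sum_v z v) => [|i].
  elim/big_rec: _ => // v y _ yS.
  by rewrite -[y]opprK SB // -[- y]add0r SB.
rewrite (bigD1 i) //= opprD addrA rpredB //; last first.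
  apply: rpred_sum => v vi; rewrite /z mulrC; apply: idealMr.
  rewrite (bigD1 i) 1?eq_sym //= mulrC; apply: idealMr.
  by have [_] := eP v i; rewrite eq_sym => /(_ vi)[].
have prodP : 1 - \prod_(j | j != i) e i j \in P i.
  apply: (big_ind (fun y => 1 - y \in P i)) => [|x y xi yi|j ji].
  - by rewrite subrr rpred0.
  - have -> : 1 - x * y = y * (1 - x) + (1 - y) by ring.
    by rewrite rpredD // idealMr.
  - by have [_ /(_ ji)[]] := eP i j.
have -> : a - z i = (a - r i) + r i * (1 - \prod_(j | j != i) e i j) by rewrite /z; ring.
by rewrite rpredD // idealMr.
Qed.

Variables (n : nat) (S : 'I_n -> {pred A}) (Y : {set 'I_n}).
Hypothesis S_cover : prime_cover p S Y.

Let kind := option ('I_t + 'I_t * 'I_t).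

Let kind_spec i (d : kind) : Prop := match d with
  | Some (inl v) => ~ forall a, exists2 s, s \in S i & a - s \in P v
  | Some (inr (u, v)) => [/\ u != v, forall a, exists2 s, s \in S i & a - s \in P u,
      forall a, exists2 s, s \in S i & a - s \in P v
      & ~ forall a, exists2 s, s \in S i & a - s \in P u /\ a - s \in P v]
  | None => onto_residues P (S i)
  end.

(** [False] for the ramified type, since the generic lift will avoid its members. *)
Let meets_kind i (d : kind) a : Prop := match d with
  | Some (inl v) => exists2 s, s \in S i & a - s \in P v
  | Some (inr (u, v)) => exists2 s, s \in S i & a - s \in P u /\ a - s \in P v
  | None => False
  end.

Lemma kind_exists i : i \in Y -> exists d, kind_spec i d.
Proof.
move=> /(S_cover.1)[sS _ _].
have [onto1|/existsNP[v nv]] :=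
    pselect (forall v a, exists2 s, s \in S i & a - s \in P v); last by exists (Some (inl v)).
have [onto2|/existsNP[u /existsNP[v /not_implyP[uv nuv]]]] := pselect (forall u v, u != v ->
    forall a, exists2 s, s \in S i & a - s \in P u /\ a - s \in P v).
  by exists None; apply: pairwise_onto_residues.
by exists (Some (inr (u, v))).
Qed.

Theorem prime_cover_bound : exists f (k : finFieldType),
  [/\ (0 < f)%N, #|k| = (p ^ f)%N,
      (tau p f <= #|[set v | `[< residual_degree (P v) p f >]]|)%N
    & (tau p f * (2 * #|max_subr k| + f * (tau p f).-1) <= 2 * n)%N].
Proof.
have [Sprop Scov] := S_cover; have [n' [rep repP]] := int_quot_finite K p_pr.
have /fin_all_exists[F /fin_all_exists[h hP]] v := residue_field p_pr (pP v).
have h_onto v : forall y, exists x, h v x = y by case: (hP v).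
have h_ker v x : (h v x == 0) = (x \in P v) by case: (hP v).
pose deg v := logn p #|F v|.
have cF v : #|F v| = (p ^ deg v)%N by case: (hP v) => _ _ charF _; exact: (card_pprimeChar charF).
have hE v x y : (x - y \in P v) -> h v x = h v y.
  by rewrite -h_ker rmorphB subr_eq0 => /eqP.
have Eh v x y : h v x = h v y -> (x - y \in P v).
  by move=> e; rewrite -h_ker rmorphB e subrr.
have /fin_all_exists[ty tyP] i : exists d, i \in Y -> kind_spec i d.
  have [iY|nY] := boolP (i \in Y); last by exists None.
  by have [d dP] := kind_exists iY; exists d.
have SD i x y : i \in Y -> x \in S i -> y \in S i -> x + y \in S i.
  move=> /Sprop[[[S0 SB] SM] _ _] xS yS.
  by rewrite -[y]opprK SB // -[- y]add0r SB.
have SB i x y : i \in Y -> x \in S i -> y \in S i -> x - y \in S i.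
  by move=> /Sprop[[[S0 SB] SM] _ _]; exact: SB.
have SM i x y : i \in Y -> x \in S i -> y \in S i -> x * y \in S i.
  by move=> /Sprop[[[S0 _] SM] _ _]; exact: SM.
have S_onto i v : (forall a, exists2 s, s \in S i & a - s \in P v) ->
    forall y, exists2 s, s \in S i & h v s = y.
  move=> H y; have [x <-] := h_onto v y; have [s sS /hE sE] := H x.
  by exists s.
have ker i u v : i \in Y -> kind_spec i (Some (inr (u, v))) ->
    (forall s, s \in S i -> h u s = 0 -> h v s = 0) /\
    (forall s, s \in S i -> h v s = 0 -> h u s = 0).
  move=> iY [uv ou ov ouv]; split=> s.
    apply: (Goursat_ker (fun x y => SD i x y iY) (fun x y => SM i x y iY)); try exact: S_onto.
    move=> H; apply: ouv => a; have [r rS [/esym/Eh ru /esym/Eh rv]] := H a.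
    by exists r.
  apply: (Goursat_ker (fun x y => SD i x y iY) (fun x y => SM i x y iY)); try exact: S_onto.
  move=> H; apply: ouv => a; have [r rS [/esym/Eh rv /esym/Eh ru]] := H a.
  by exists r.
have deg_eq i u v : i \in Y -> kind_spec i (Some (inr (u, v))) -> deg u = deg v.
  move=> iY iuv; have [k1 k2] := ker _ _ _ iY iuv; have [_ ou ov _] := iuv.
  rewrite /deg; congr logn; apply/anti_leq; apply/andP; split.
    exact: (Goursat_card (fun x y => SB i x y iY) (S_onto _ _ ou) k2).
  exact: (Goursat_card (fun x y => SB i x y iY) (S_onto _ _ ov) k1).
pose kdeg (d : kind) := match d with
  | Some (inl v) => deg v | Some (inr (u, _)) => deg u | None => 0%N end.
(* If each degree f had an element [b f] met by no member of degree f, a generic lift of an a0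
   congruent to [b (deg v)] at each [P v] would lie in no member; a linked pair sees a single [b f],
   its degrees being equal. *)
have [f fcov] : exists f, forall a, exists i, [/\ i \in Y, ty i <> None, kdeg (ty i) = f
    & meets_kind i (ty i) a].
  apply: contrapT => H.
  have /choice[b bP] : forall f, exists a, forall i, i \in Y -> ty i <> None ->
      kdeg (ty i) = f -> ~ meets_kind i (ty i) a.
    move=> f; apply: contrapT => H'; apply: H; exists f => a; apply: contrapT => H''.
    by apply: H'; exists a => i iY nN kf im; apply: H''; exists i.
  have [a0 a0P] := residues_onto repP pP P_inj (fun v => b (deg v)).
  have [a [aP ageneric]] := generic_element p_pr pP P_inj P_all a0.
  have abP v : b (deg v) - a \in P v.
    have -> : b (deg v) - a = - (a0 - b (deg v)) - (a - a0) by ring.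
    by apply: rpredB; [rewrite rpredN; exact: a0P | exact: aP].
  have [i iY aS] := Scov a; have [sS pS [x0 x0S]] := Sprop i iY.
  have meet_b v : exists2 s, s \in S i & b (deg v) - s \in P v by exists a.
  have := tyP i iY; have := bP _ i iY _ erefl.
  case E: (ty i) => [[v|[u v]]|] /=.
  - by move=> nb _; apply: nb => //; exact: meet_b.
  - move=> nb iuv; have duv := deg_eq _ _ _ iY iuv; apply: nb => //.
    by exists a => //; split=> //; rewrite duv.
  - by move=> _ /(ageneric _ sS pS aS) full; rewrite full in x0S.
have f_gt0 : (0 < f)%N.
  have [i [iY nN <- _]] := fcov 0.
  have dpos v : (0 < deg v)%N.
    have : (1 < p ^ deg v)%N by rewrite -cF finNzRing_gt1.
    by case: (deg v).
  by case: (ty i) nN => [[v|[u v]]|] nN; [exact: dpos|exact: dpos|case: nN].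
(* All residue fields of degree f are identified with one [k], which turns the links between them
   into graphs. *)
have [k charp ck] := pPrimePowerField p_pr f_gt0.
pose V := {v : 'I_t | deg v == f}; pose VT : finType := V.
have /fin_all_exists[pi piP] (v : V) : exists g : {rmorphism A -> k},
    (forall y, exists x, g x = y) /\ forall x y, (x - y \in P (val v)) <-> g x = g y.
  have [g g_bij] := finField_iso p_pr f_gt0 (etrans (cF (val v)) (congr1 (expn p) (eqP (valP v)))) ck.
  exists (g \o h (val v)); split=> [y|x y].
    have [g' _ g'K] := g_bij; have [x xE] := h_onto (val v) (g' y).
    by exists x; rewrite /= xE g'K.
  split=> [/hE|] /=; first by move=> ->.
  by move=> /(bij_inj g_bij)/Eh.
have pi_onto v y : exists x, pi v x = y by case: (piP v).
have piE v x y : (x - y \in P (val v)) <-> pi v x = pi v y by case: (piP v).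
pose B := [set i | [&& i \in Y, ty i != None & kdeg (ty i) == f]].
have shapeP (i : {i | i \in B}) : exists sh : residue_shape k VT, proper_shape sh /\
    forall a, meets_kind (val i) (ty (val i)) a -> meets [ffun v : VT => pi v a] sh.
  case: i => i /=; rewrite inE => /and3P[iY nN /eqP kf].
  have := tyP i iY; case E: (ty i) nN kf => [[v|[u v]]|] // _ kf.
  - move=> nv; pose w : V := exist _ v (introT eqP kf).
    pose M := [set y : k | `[< exists2 s, s \in S i & y = pi w s >]].
    exists (Inert w M); split=> [|a [s sS as_]] /=; last first.
      by rewrite inE ffunE; apply/asboolP; exists s => //; apply/piE.
    split.
      have [[[S0 _] _] _ _] := Sprop i iY.
      apply/subrP; split=> [|x y|x y]; rewrite !inE.
      + by apply/asboolP; exists 0; rewrite ?rmorph0.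
      + by move=> /asboolP[s sS ->] /asboolP[s' s'S ->]; apply/asboolP; exists (s - s'); rewrite ?rmorphB // SB.
      + by move=> /asboolP[s sS ->] /asboolP[s' s'S ->]; apply/asboolP; exists (s * s'); rewrite ?rmorphM // SM.
    apply/eqP => MT; apply: nv => a; have := in_setT (pi w a); rewrite -MT !inE.
    by move=> /asboolP[s sS sa]; exists s => //; apply/(piE w).
  - move=> iuv; have duv := deg_eq _ _ _ iY iuv; have [k1 k2] := ker _ _ _ iY iuv.
    have [uv ou ov ouv] := iuv.
    have kf' : deg v == f by rewrite -duv -[deg u]/(kdeg (Some (inr (u, v)))) kf.
    pose w : V := exist _ u (introT eqP kf); pose w' : V := exist _ v kf'.
    pose G := [set z : k * k | `[< exists2 s, s \in S i & z = (pi w s, pi w' s) >]].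
    have inG x y : reflect (exists2 s, s \in S i & (x, y) = (pi w s, pi w' s)) ((x, y) \in G).
      by rewrite inE; exact: asboolP.
    have pi0 (x : V) s : pi x s = 0 -> h (val x) s = 0.
      by rewrite -(rmorph0 (pi x)) => /piE; rewrite subr0 -h_ker => /eqP.
    have h0 (x : V) s : h (val x) s = 0 -> pi x s = 0.
      by move=> /eqP; rewrite h_ker -[s in s \in _]subr0 => /piE ->; rewrite rmorph0.
    exists (Diag w w' G); split=> [|a [s sS [au av]]] /=; last first.
      by rewrite !ffunE; apply/inG; exists s => //; congr (_, _); apply/piE.
    split; first by rewrite -(inj_eq val_inj).
    split=> [x y x' y'|x y x' y'|x|y|x|y].
    + move=> /inG[s sS [-> ->]] /inG[s' s'S [-> ->]]; apply/inG.
      by exists (s - s'); rewrite ?rmorphB // SB.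
    + move=> /inG[s sS [-> ->]] /inG[s' s'S [-> ->]]; apply/inG.
      by exists (s * s'); rewrite ?rmorphM // SM.
    + have [a <-] := pi_onto w x; have [s sS /(piE w) sa] := ou a.
      by exists (pi w' s); apply/inG; exists s; rewrite ?sa.
    + have [a <-] := pi_onto w' y; have [s sS /(piE w') sa] := ov a.
      by exists (pi w s); apply/inG; exists s; rewrite ?sa.
    + move=> /inG[s sS [-> /esym/pi0 s0]]; apply: h0; exact: k2.
    + move=> /inG[s sS [/esym/pi0 s0 ->]]; apply: h0; exact: k1.
have /fin_all_exists[sh shP] := shapeP.
have sh_proper i := (shP i).1; have sh_meets i := (shP i).2.
have [cs [cs_uniq csP cs_size]] := conj_polys p_pr f_gt0.
have sh_covers r : exists i, meets r (sh i).
  have P_inj' (u v : V) : P (val u) =i P (val v) -> u = v by move=> /P_inj/val_inj.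
  have /fin_all_exists[y yP] v := pi_onto v (r v).
  have [a aP] := residues_onto repP (fun v : V => pP (val v)) P_inj' y.
  have [i [iY nN kf im]] := fcov a.
  have iB : i \in B by rewrite inE iY kf eqxx andbT /=; apply/eqP.
  exists (exist _ i iB); have := sh_meets (exist _ i iB) a im.
  congr (is_true (meets _ _)); apply/ffunP => v; rewrite ffunE -yP.
  exact/piE.
have [cV bound] := residue_cover_bound charp ck f_gt0 cs_uniq csP sh_proper sh_covers.
have cVE : #|{: V}| = #|[set v | deg v == f]|.
  by rewrite card_sig; apply: eq_card => v; rewrite !inE.
exists f, k; split=> //.
  rewrite -cs_size (leq_trans cV) // cVE subset_leq_card //.
  apply/subsetP => v; rewrite !inE => /eqP vf; apply/asboolP.
  by case: (hP v) => _ _ _ /(_ f)[_]; apply; rewrite cF vf.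
rewrite -cs_size (leq_trans bound) // leq_mul // card_sig.
by rewrite -[leqRHS]card_ord max_card.
Qed.

End PrimeCoverBound.

(** * Covering numbers of quotients *)

Local Open Scope classical_set_scope.
Local Open Scope ring_scope.

Lemma setcard_infinite (T : choiceType) (E : set T) : ~ finite_set E -> setcard E = 0%N.
Proof. by move=> nE; rewrite /setcard /fset_set; case: pselect. Qed.

Lemma mem_setcard (T : choiceType) (E : set T) x : finite_set E -> x \in fset_set E <-> E x.
Proof. by move=> fE; rewrite in_fset_set // in_setE. Qed.

Lemma leq_setcard (T T' : choiceType) (E : set T) (E' : set T') (h : T -> T') :
  finite_set E' -> (forall x, E x -> E' (h x)) ->
  (forall x y, E x -> E y -> h x = h y -> x = y) -> (setcard E <= setcard E')%N.
Proof.
move=> fE' hE hinj; have [fE|nE] := pselect (finite_set E); last by rewrite setcard_infinite.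
rewrite /setcard -(size_map h); apply: uniq_leq_size.
  rewrite map_inj_in_uniq ?fset_uniq // => x y /(mem_setcard _ fE) xE /(mem_setcard _ fE) yE.
  exact: hinj.
by move=> _ /mapP[x /(mem_setcard _ fE) xE ->]; apply/(mem_setcard _ fE')/hE.
Qed.

Lemma ord_leq_setcard (T : choiceType) (E : set T) m (g : 'I_m -> T) :
  finite_set E -> (forall i, E (g i)) -> injective g -> (m <= setcard E)%N.
Proof.
move=> fE gE g_inj; rewrite -[m in leqLHS]card_ord cardE -(size_map g) /setcard.
apply: uniq_leq_size; first by rewrite map_inj_uniq ?enum_uniq.
by move=> _ /mapP[i _ ->]; apply/(mem_setcard _ fE).
Qed.

(** [covnum] is well-ordered, so a nonempty set has a least element; this keeps [infimum] from a
    spurious default value. *)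
Lemma covinf_infimums (E : set covnum) : E !=set0 -> infimums E !=set0.
Proof.
move=> E0; suff [u Eu ulb] : exists2 u, E u & forall v, E v -> (u <= v)%O.
  by exists u; split=> // v vlb; exact: vlb.
have [[n En]|nFin] := pselect (exists n, E (Fin n)).
  have ex : exists n, `[< E (Fin n) >] by exists n; apply/asboolP.
  case: (ex_minnP ex) => m /asboolP Em mmin; exists (Fin m) => // -[j||] Ej //.
  by apply: mmin; apply/asboolP.
have [EI|nI] := pselect (E Infty).
  by exists Infty => // -[j||] Ej //; case: nFin; exists j.
case: E0 => -[j||] Ej; [by case: nFin; exists j | by [] |].
by exists HatInfty => // -[j'||] Ej' //; case: nFin; exists j'.
Qed.

Lemma le_covinf (E : set covnum) v : (forall u, E u -> (v <= u)%O) -> (v <= covinf E)%O.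
Proof.
move=> vlb; rewrite /covinf /infimum; case: eqP => [_|/eqP/set0P E0]; first by case: v vlb.
by case: xgetP => [x _ [_ xub]|/(_ _)]; [exact: xub | have [y yE] := covinf_infimums E0; move=> /(_ y)].
Qed.

Lemma covinf_le (E : set covnum) v : E v -> (covinf E <= v)%O.
Proof.
move=> Ev; rewrite /covinf /infimum; case: eqP => [E0|_]; first by rewrite E0 in Ev.
have E0 : E !=set0 by exists v.
case: xgetP => [x _ [xlb _]|]; first exact: xlb.
by have [y yE] := covinf_infimums E0; move=> /(_ y).
Qed.

Lemma covinf_eq (E : set covnum) v : (exists2 u, E u & (u <= v)%O) ->
  (forall u, E u -> (v <= u)%O) -> v = covinf E.
Proof.
move=> [u Eu uv] vlb; apply/le_anti; rewrite le_covinf //=.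
exact: le_trans (covinf_le Eu) uv.
Qed.

Lemma sigma_covered (R : comPzRingType) n : covered_by R n -> (sigma R <= Fin n)%O.
Proof.
move=> Rn; rewrite /sigma asboolT; last by exists n.
case: xgetP => [m _ [_ mmin]|/(_ _) H]; first exact: mmin.
have ex : exists n, `[< covered_by R n >] by exists n; apply/asboolP.
case: (ex_minnP ex) => m /asboolP Rm mmin; case: (H m); split=> // j Rj.
by apply: mmin; apply/asboolP.
Qed.

Lemma sigma_finP (R : comPzRingType) : finitely_coverable R ->
  exists2 n, sigma R = Fin n & covered_by R n.
Proof.
move=> fR; rewrite /sigma asboolT //; exists (xget 0%N [set n | covered_by R n /\ forall m, covered_by R m -> (n <= m)%N]) => //.
case: xgetP => [m _ [//]|H].
have ex : exists n, `[< covered_by R n >] by case: fR => n Rn; exists n; apply/asboolP.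
case: (ex_minnP ex) => m /asboolP Rm mmin; case: (H m); split=> // j Rj.
by apply: mmin; apply/asboolP.
Qed.

Lemma covered_by_onto (R R' : comPzRingType) (h : {rmorphism R -> R'}) n :
  (forall y, exists x, h x = y) -> covered_by R' n -> covered_by R n.
Proof.
move=> h_onto [S [Sproper Scov]]; exists (fun i x => h x \in S i); split=> [i|x].
  have [[[S0 SB] SM] [y yS]] := Sproper i; have [x xy] := h_onto y.
  split; last by exists x; rewrite unfold_in xy.
  split; first split; rewrite ?unfold_in ?rmorph0 // => a b; rewrite !unfold_in.
    by rewrite rmorphB; exact: SB.
  by rewrite rmorphM; exact: SM.
by have [i xS] := Scov (h x); exists i.
Qed.

Lemma sigma_onto (R R' : comPzRingType) (h : {rmorphism R -> R'}) :
  finitely_coverable R -> (forall y, exists x, h x = y) -> (sigma R <= sigma R')%O.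
Proof.
move=> fR h_onto; have [n Rn nR] := sigma_finP fR.
have [fR'|nfR'] := pselect (finitely_coverable R').
  have [m -> mR'] := sigma_finP fR'; apply: sigma_covered.
  exact: covered_by_onto mR'.
by rewrite Rn /sigma asboolF //; case: ifP.
Qed.

Lemma sigma_quot (R : comNzRingType) (I : idealr R) :
  finitely_coverable R -> (sigma R <= sigma {ideal_quot I})%O.
Proof.
move=> fR; apply: (@sigma_onto _ _ (\pi_{ideal_quot I} : {rmorphism R -> _})) => // y.
by exists (generic_quotient.repr y); exact: reprK.
Qed.

Lemma quot_lift (R : comNzRingType) (I : idealr R) (k : pzRingType) (g : {rmorphism R -> k}) :
  (forall x, x \in I -> g x = 0) ->
  exists g' : {rmorphism {ideal_quot I} -> k}, forall x, g' (\pi_{ideal_quot I} x) = g x.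
Proof.
move=> gI; pose g' (y : {ideal_quot I}) := g (generic_quotient.repr y).
have g'E x : g' (\pi_{ideal_quot I} x) = g x.
  apply/eqP; rewrite -subr_eq0 -rmorphB; apply/eqP/gI.
  by rewrite Quotient.idealrBE reprK.
have lift y : exists x, y = \pi_{ideal_quot I} x by exists (generic_quotient.repr y); rewrite reprK.
have g'B : zmod_morphism g'.
  move=> y z; have [a ->] := lift y; have [b ->] := lift z.
  by rewrite -rmorphB !g'E rmorphB.
have g'M : monoid_morphism g'.
  split=> [|y z]; first by rewrite -(rmorph1 \pi_{ideal_quot I}) g'E rmorph1.
  have [a ->] := lift y; have [b ->] := lift z.
  by rewrite -rmorphM !g'E rmorphM.
pose gA := GRing.isZmodMorphism.Build _ _ g' g'B.
pose gM := GRing.isMonoidMorphism.Build _ _ g' g'M.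
pose G : {rmorphism {ideal_quot I} -> k} := HB.pack g' gA gM.
by exists G.
Qed.

Lemma prod_ring_proj (I : Type) (R_ : I -> comPzRingType) (i : I) :
  exists g : {rmorphism prod_ring R_ -> R_ i}, forall x, g x = x i.
Proof.
pose g (x : prod_ring R_) := x i.
have gB : zmod_morphism g by [].
have gM : monoid_morphism g by [].
pose gA := GRing.isZmodMorphism.Build _ _ g gB.
pose gMM := GRing.isMonoidMorphism.Build _ _ g gM.
pose G : {rmorphism prod_ring R_ -> R_ i} := HB.pack g gA gMM.
by exists G.
Qed.

Lemma prod_ring_map (R : comPzRingType) (I : Type) (R_ : I -> comPzRingType)
  (g : forall i, {rmorphism R -> R_ i}) :
  exists h : {rmorphism R -> prod_ring R_}, forall x i, h x i = g i x.
Proof.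
pose h x : prod_ring R_ := fun i => g i x.
have hB : zmod_morphism h.
  by move=> x y; apply: functional_extensionality_dep => i; exact: rmorphB.
have hM : monoid_morphism h.
  split=> [|x y]; apply: functional_extensionality_dep => i; first exact: rmorph1.
  exact: rmorphM.
pose hA := GRing.isZmodMorphism.Build _ _ h hB.
pose hMM := GRing.isMonoidMorphism.Build _ _ h hM.
pose H : {rmorphism R -> prod_ring R_} := HB.pack h hA hMM.
by exists H.
Qed.

(** * Primes over p and the quotients attached to them *)

Section PrimesOver.
Variables (K : fieldExtType rat) (p : nat) (p_pr : prime p).
Local Notation A := (ring_int K).
Implicit Types P Q : prime_idealr A.

Lemma lies_overP P : lies_over P p <-> p%:R \in P.
Proof.
split=> [/(_ p%:Z)|pP z]; first by rewrite -pmulrn dvdzz.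
apply/idP/idP => [zP|/dvdzP[q ->]]; last first.
  by rewrite rmorphM /=; apply: idealMr; rewrite -pmulrn.
apply: contraT => pz; have cop : coprimez p z by rewrite coprimezE prime_coprime.
have [[u v] /= uv] := coprimezP _ _ cop; have := idealr1 P.
have -> : 1 = u%:~R * p%:R + v%:~R * z%:~R :> A.
  by have := congr1 (fun z : int => z%:~R : A) uv; rewrite rmorphD !rmorphM /= -pmulrn.
by rewrite rpredD // idealMr.
Qed.

Lemma finite_primes_over f :
  finite_set [set X : set A | exists P : prime_idealr A, X = [set` P] /\ prime_over p f P].
Proof.
have [n [rep repP]] := int_quot_finite K p_pr.
have [t [P [pP P_inj P_all]]] := primes_above_enum repP.
apply: (@sub_finite_set _ _ (range (fun i : 'I_t => [set` P i]))); last exact: finite_image.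
move=> _ [Q [-> [/lies_overP pQ _]]]; have [i Qi] := P_all Q pQ.
by exists i => //; apply/seteqP; split=> x /=; rewrite Qi.
Qed.

Lemma family_nb_primes f m (Q : 'I_m -> prime_idealr A) : (forall i, prime_over p f (Q i)) ->
  (forall i j, Q i =i Q j -> i = j) -> (m <= nb_primes K p f)%N.
Proof.
move=> Qf Q_inj; apply: (@ord_leq_setcard _ _ _ (fun i => [set` Q i])).
- exact: finite_primes_over.
- by move=> i; exists (Q i).
- by move=> i j /seteqP[ij ji]; apply: Q_inj => x; apply/idP/idP; [exact: ij|exact: ji].
Qed.

Lemma prime_over_hom f (k : finFieldType) P : (0 < f)%N -> #|k| = (p ^ f)%N -> prime_over p f P ->
  exists g : {rmorphism {ideal_quot P} -> k}, forall y, exists x, g x = y.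
Proof.
move=> f0 ck [/lies_overP pP Pf]; have [F [h [h_onto h_ker charF hf]]] := residue_field p_pr pP.
have [g [g' _ g'K]] := finField_iso p_pr f0 ((hf f).1 Pf) ck.
have [|G GE] := @quot_lift A P k (g \o h).
  by move=> x; rewrite -h_ker /= => /eqP->; rewrite rmorph0.
exists G => y; have [x xE] := h_onto (g' y).
by exists (\pi x); rewrite GE /= xE g'K.
Qed.

(** The quantity bounded by 2n is twice the number of subrings in the explicit cover, which pulls
    back to [R]. [R] is general in order to serve both for quotients of A and for products of
    residue rings. *)
Lemma covered_by_residues (f n : nat) (k : finFieldType) (T : finType) (P : T -> prime_idealr A)
    (R : comPzRingType) (h : forall i, {rmorphism R -> {ideal_quot P i}}) :
  (0 < f)%N -> #|k| = (p ^ f)%N -> #|T| = tau p f ->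
  (tau p f * (2 * #|max_subr k| + f * (tau p f).-1) <= 2 * n)%N ->
  (forall i, prime_over p f (P i)) ->
  (forall y : forall i, {ideal_quot P i}, exists x, forall i, h i x = y i) ->
  exists2 m, (m <= n)%N & covered_by R m.
Proof.
move=> f0 ck cT bound Pf h_onto; have charp := card_finPcharP ck p_pr.
have /fin_all_exists[g g_onto] i := prime_over_hom f0 ck (Pf i).
have [cs [cs_uniq csP cs_size]] := conj_polys p_pr f0.
have [|m Rm mE] := @residue_cover_exists p f k charp ck f0 cs cs_uniq csP R T
  (fun i => g i \o h i) _ (etrans cT (esym cs_size)).
  move=> r; have /(fin_all_exists (P := fun i x => g i x = r i))[y yE] :
    forall i, exists x, g i x = r i by move=> i; exact: g_onto.
  by have [x xE] := h_onto y; exists x => i; rewrite /= xE.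
exists m => //; move: bound; rewrite -cs_size /= -mE.
by rewrite leq_mul2l.
Qed.

Lemma quot_residues_onto (T : finType) (P : T -> prime_idealr A) (I : idealr A) :
  (forall i, p%:R \in P i) -> (forall i j, P i =i P j -> i = j) ->
  (forall i, {subset I <= P i}) ->
  exists h : forall i, {rmorphism {ideal_quot I} -> {ideal_quot P i}},
    forall y : forall i, {ideal_quot P i}, exists x, forall i, h i x = y i.
Proof.
move=> pP P_inj IP; have [n [rep repP]] := int_quot_finite K p_pr.
have H i : exists g : {rmorphism {ideal_quot I} -> {ideal_quot P i}}, forall x, g (\pi x) = \pi x.
  apply: quot_lift => x /(IP i) xP; transitivity (\pi_{ideal_quot P i} (0 : A)); last exact: rmorph0.
  by apply/eqP; rewrite -Quotient.idealrBE subr0.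
have [h hE] := fin_all_exists H; exists h => y.
have [x xP] := residues_onto repP pP P_inj (fun i => generic_quotient.repr (y i)).
exists (\pi x) => i; rewrite hE -[y i]reprK; apply/eqP.
by rewrite -Quotient.idealrBE.
Qed.

Lemma prod_residues_onto (T : finType) (P : T -> prime_idealr A) :
  (forall i, p%:R \in P i) -> (forall i j, P i =i P j -> i = j) ->
  exists h : {rmorphism A -> prod_ring (fun i => {ideal_quot P i})}, forall y, exists x, h x = y.
Proof.
move=> pP P_inj; have [n [rep repP]] := int_quot_finite K p_pr.
have [h hE] := @prod_ring_map A T (fun i => {ideal_quot P i}) (fun i => \pi_{ideal_quot P i}).
exists h => y.
have [x xP] := residues_onto repP pP P_inj (fun i => generic_quotient.repr (y i)).
exists x; apply: functional_extensionality_dep => i; rewrite hE -[y i]reprK; apply/eqP.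
by rewrite -Quotient.idealrBE.
Qed.

Lemma finite_prime_divisors (I : idealr A) f : finite_set [set X : set A |
  exists P : prime_idealr A, [/\ X = [set` P], prime_over p f P & ideal_divides P I]].
Proof.
by apply: sub_finite_set (finite_primes_over f) => _ [P [-> Pf _]]; exists P.
Qed.

(** Provides the faulty ideal. [P i] and the intersection L of the other primes are comaximal, so
    their product is the whole intersection; [i0] makes it proper. *)
Lemma prime_intersection (T : finType) (P : T -> prime_idealr A) (i0 : T) :
  (forall i, p%:R \in P i) -> (forall i j, P i =i P j -> i = j) ->
  exists I : idealr A, [/\ forall i, {subset I <= P i}, p%:R \in I
    & forall i, ideal_divides (P i) I].
Proof.
move=> pP P_inj; have [n [rep repP]] := int_quot_finite K p_pr.
pose J : {pred A} := fun x => [forall i, x \in P i].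
have JP x : reflect (forall i, x \in P i) (x \in J) by exact: forallP.
have idJ : idealr_closed J.
  split=> [||a x y /JP xJ /JP yJ]; first by apply/JP => i; exact: rpred0.
    by apply/JP => /(_ i0); rewrite idealr1.
  by apply/JP => i; apply: rpredD; [exact: idealMr (xJ i) | exact: yJ].
pose iM := isIdealr.Build A J idJ; pose I : idealr A := HB.pack J iM.
exists I; split=> [i x /JP //||i]; first exact/JP.
pose L : {pred A} := fun x => [forall j, (j != i) ==> (x \in P j)].
have LP x : reflect (forall j, j != i -> x \in P j) (x \in L).
  by apply: (iffP forallP) => H j; [move=> ji; have := H j; rewrite ji | apply/implyP; exact: H].
have [e [eP eL]] := prime_idempotent repP pP P_inj i.
exists L.
  split; first split.
  - by apply/LP => j _; exact: rpred0.
  - by move=> x y /LP xL /LP yL; apply/LP => j ji; rewrite rpredB ?xL ?yL.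
  - by move=> a x /LP xL; apply/LP => j ji; rewrite idealMr ?xL.
apply/seteqP; split=> x /=.
  (* x = (1 - e) x + x e, with 1 - e in [P i] and e in L. *)
  move=> /JP xJ; exists 2%N, (fun k : 'I_2 => if k == 0 then 1 - e else x),
    (fun k : 'I_2 => if k == 0 then x else e); split.
    case=> [[|[|//]] /= ?]; split.
    - by rewrite -opprB rpredN.
    - by apply/LP => j _.
    - exact: xJ.
    - by apply/LP.
  by rewrite big_ord_recl big_ord1 /=; ring.
move=> [m [a [b [ab ->]]]]; apply/JP => j; apply: rpred_sum => k _.
have [aP bL] := ab k; have [->|ji] := eqVneq j i; first by rewrite mulrC idealMr.
by rewrite idealMr //; exact: (LP _ bL).
Qed.

Lemma pA_sub P : p%:R \in P -> {subset pA K p_pr <= P}.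
Proof. by move=> pP x /asboolP[a ->]; rewrite mulrC idealMr. Qed.

End PrimesOver.

(** * Indices and common index divisors *)

Section CommonIndexDivisors.
Variable K : fieldExtType rat.
Local Notation A := (ring_int K).
Variable theta : A.
Local Notation M := (int_adjoin theta).

Lemma int_adjoinB x y : M x -> M y -> M (x - y).
Proof. by move=> [q ->] [r ->]; exists (q - r); rewrite rmorphB hornerD hornerN. Qed.

Lemma int_adjoin0 : M 0.
Proof. by exists 0; rewrite rmorph0 horner0. Qed.

(* Lagrange's theorem: translation by a permutes the cosets of Z[theta]; compare the sums of
   their representatives. *)
Lemma adjoin_index_mul : (0 < adjoin_index theta)%N -> forall a, M ((adjoin_index theta)%:R * a).
Proof.
pose coset a := [set a + z | z in M]; rewrite /adjoin_index -/coset.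
set C := range coset => C_gt0 a.
have finC : finite_set C by apply: contrapT => /setcard_infinite C0; rewrite C0 in C_gt0.
have cosetP x y : coset x = coset y -> M (x - y).
  move=> xy; have : coset x x by exists 0; [exact: int_adjoin0 | rewrite addr0].
  by rewrite xy => -[z zM <-]; rewrite addrC addKr.
have cosetE x y : M (x - y) -> coset x = coset y.
  move=> xy; apply/seteqP; split=> _ [z zM <-].
    exists (x - y - (0 - z)); first by do !apply: int_adjoinB => //; exact: int_adjoin0.
    by ring.
  exists (z - (x - y)); first exact: int_adjoinB.
  by ring.
set s := fset_set C; have sP X : X \in s <-> C X by exact: mem_setcard.
have /choice[r rP] : forall X, exists x, C X -> X = coset x.
  move=> X; have [[x _ <-]|nX] := pselect (C X); first by exists x.
  by exists 0 => /nX.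
pose T X := coset (a + r X).
have T_inj : {in s &, injective T}.
  move=> X Y /sP CX /sP CY /cosetP; have -> : a + r X - (a + r Y) = r X - r Y by ring.
  by move/cosetE; rewrite -(rP X CX) -(rP Y CY).
have Ts : {subset [seq T X | X <- s] <= s}.
  by move=> _ /mapP[X _ ->]; apply/sP; exists (a + r X).
have perm_T : perm_eq [seq T X | X <- s] s.
  have uT : uniq [seq T X | X <- s] by rewrite map_inj_in_uniq ?fset_uniq.
  have [_ Tes] := uniq_min_size uT Ts (eq_leq (esym (size_map T s))).
  by apply: uniq_perm; rewrite ?fset_uniq.
have : M (\sum_(X <- s) (a + r X - r (T X))).
  rewrite big_seq; elim/big_rec: _ => [|X y /sP CX My]; first exact: int_adjoin0.
  have -> : a + r X - r (T X) + y = (a + r X - r (T X)) - (0 - y) by ring.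
  apply: int_adjoinB; last by apply: int_adjoinB => //; exact: int_adjoin0.
  by apply: cosetP; rewrite -rP //; exists (a + r X).
rewrite big_split /= sumrN -(big_map T xpredT r) (perm_big _ perm_T) /= big_split /= addrK.
by rewrite big_const_seq count_predT iter_addr_0 mulr_natl.
Qed.

(** Dedekind's argument: as p does not divide the index, A = Z[theta] + pA, so the image of theta
    generates each residue field of degree f, and its minimal polynomial over F_p determines the
    prime. *)
Lemma nb_primes_le_irr p f : prime p -> (1 < f)%N -> ~~ (p %| adjoin_index theta)%N ->
  (nb_primes K p f <= nb_irr p f)%N.
Proof.
move=> p_pr f_gt1 pN; have f_gt0 := ltnW f_gt1.
have full (a : A) : exists (q : {poly int}) (c : A), a = (map_poly intr q).[theta] + p%:R * c.
  (* Index 0 stands for an infinite index, and p divides 0. *)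
  have N_gt0 : (0 < adjoin_index theta)%N by rewrite lt0n; apply: contraNneq pN => ->; rewrite dvdn0.
  have cop : coprimez p (adjoin_index theta) by rewrite coprimezE prime_coprime.
  have [[u v] /= uv] := coprimezP _ _ cop.
  have [q qE] := adjoin_index_mul N_gt0 a.
  exists (v%:P * q), (u%:~R * a).
  rewrite rmorphM /= map_polyC hornerM hornerC -qE /= -{1}[a]mul1r.
  have one : 1 = u%:~R * p%:R + v%:~R * (adjoin_index theta)%:R :> A.
    by have := congr1 (fun z : int => z%:~R : A) uv; rewrite rmorphD !rmorphM /= -!pmulrn.
  by rewrite [X in X * a = _]one; ring.
pose spec (P : prime_idealr A) (q : {poly 'F_p}) (F : finFieldType) (h : {rmorphism A -> F})
    (charF : p \in [pchar F]) :=
  (forall x, (h x == 0) = (x \in P)) /\ root (map_poly (Fp_embed charF) q) (h theta).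
have evE (F : finFieldType) (h : {rmorphism A -> F}) (charF : p \in [pchar F]) (r : {poly int}) :
    h (map_poly intr r).[theta] = (map_poly (Fp_embed charF) (map_poly intr r)).[h theta].
  rewrite -horner_map -!map_poly_comp; congr (_.[_]); apply: eq_map_poly => z /=.
  by rewrite !rmorph_int.
have /choice[Q QP] : forall X : set A, exists q : {poly 'F_p},
    (exists P : prime_idealr A, X = [set` P] /\ prime_over p f P) ->
    conj_poly f q /\ exists (P : prime_idealr A) (F : finFieldType) (h : {rmorphism A -> F})
      (charF : p \in [pchar F]), X = [set` P] /\ spec P q F h charF.
  move=> X; have [[P [XP [/(lies_overP p_pr) pP Pf]]]|nX] :=
    pselect (exists P : prime_idealr A, X = [set` P] /\ prime_over p f P); last by exists 0 => /nX.
  have [F [h [h_onto h_ker charF hf]]] := residue_field p_pr pP.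
  have cF := (hf f).1 Pf.
  have hp0 c : h (p%:R * c) = 0 by rewrite rmorphM rmorph_nat (pcharf0 charF) mul0r.
  have xg : h theta \in gens F.
    (* If theta vanished here, every residue would be an integer and fixed by Frobenius, whereas for
       f > 1 Frobenius moves the generators. *)
    have [x0|x0] := eqVneq (h theta) 0.
      have [g gg] := gens_nonempty F; have [a aE] := h_onto g; have [q [c aq]] := full a.
      have gE : g = (q`_0)%:~R.
        rewrite -aE aq rmorphD hp0 addr0 (evE _ _ charF) x0 horner_coef0 !coef_map /=.
        by rewrite rmorph_int.
      suff : 0%N = 1%N by [].
      apply: (gens_expr_inj charF cF gg) => //.
      rewrite expn0 expn1 expr1 -(pFrobenius_autE charF) gE.
      by rewrite (rmorph_int (pFrobenius_aut charF : {rmorphism F -> F})).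
    apply/gensP => B sB xB; apply/setP => y; rewrite in_setT.
    have [a <-] := h_onto y; have [q [c ->]] := full a.
    rewrite rmorphD hp0 addr0 (evE _ _ charF); apply: subr_horner => //.
    exact: subr1 xB x0.
  have [q cq qx] := gens_root charF cF f_gt0 xg.
  by exists q => _; split=> //; exists P, F, h, charF.
apply: (@leq_setcard _ _ _ _ Q).
- by apply: sub_finite_set (size_le_finite _ f.+1) => q /= [_ _ ->].
- by move=> X /QP[[mq iq sq _] _].
move=> X Y /QP[[_ iq _ _] [P [F [h [charF [XE [Pker Prt]]]]]]].
move=> /QP[_ [P' [F' [h' [charF' [YE [P'ker P'rt]]]]]]] QE; rewrite -QE in P'rt.
have half (G G' : finFieldType) (g : {rmorphism A -> G}) (g' : {rmorphism A -> G'})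
    (cG : p \in [pchar G]) (cG' : p \in [pchar G']) a :
    root (map_poly (Fp_embed cG) (Q X)) (g theta) ->
    root (map_poly (Fp_embed cG') (Q X)) (g' theta) -> g a = 0 -> g' a = 0.
  move=> gr g'r; have [r [c ->]] := full a.
  rewrite !rmorphD !rmorphM !rmorph_nat (pcharf0 cG) (pcharf0 cG') !mul0r !addr0.
  rewrite (evE _ _ cG) (evE _ _ cG') => /rootP rr; apply/rootP.
  have /dvdpP[d ->] := common_root_dvdp iq gr rr.
  by rewrite rmorphM rootM g'r orbT.
rewrite XE YE; apply/seteqP; split=> a /=.
  by rewrite -Pker -P'ker => /eqP /(half _ _ _ _ _ _ _ Prt P'rt)->.
by rewrite -Pker -P'ker => /eqP /(half _ _ _ _ _ _ _ P'rt Prt)->.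
Qed.

End CommonIndexDivisors.

Lemma common_index_divisorP (K : fieldExtType rat) p : prime p ->
  (forall theta : ring_int K, (p %| adjoin_index theta)%N) -> common_index_divisor K p.
Proof.
move=> p_pr pdiv; split=> //; rewrite /field_index.
case: xgetP => [d _ [_ dmax]|H]; first by apply: dmax => theta _; exact: pdiv.
pose dv e := `[< forall theta : ring_int K, primitive_elt theta -> (e %| adjoin_index theta)%N >].
have [[theta [th_prim th0]]|nex] :=
    pselect (exists theta : ring_int K, primitive_elt theta /\ (0 < adjoin_index theta)%N).
  (* The gcd is built as the lcm of all common divisors, which one positive index bounds. *)
  pose d := \big[lcmn/1%N]_(e < (adjoin_index theta).+1 | dv e) (e : nat).
  case: (H d); split=> [th thP|e eP].
    rewrite /d; elim/big_rec: _ => [|e x /asboolP ev xd]; first exact: dvd1n.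
    by rewrite dvdn_lcm xd ev.
  have eN : (e < (adjoin_index theta).+1)%N by rewrite ltnS dvdn_leq ?eP.
  rewrite /d (bigD1 (Ordinal eN)) /= ?dvdn_lcml //.
  exact/asboolP.
(* Here all indices of primitive elements are 0, and so is their gcd. *)
case: (H 0%N); split=> // th thP; rewrite dvd0n.
by apply: contrapT => /negP; rewrite -lt0n => th0; apply: nex; exists th.
Qed.

(** In degree at least 2, an excess of primes over irreducible polynomials forces p to divide every
    index; degree 1 is the second clause of [frakP]. *)
Lemma frakP_frakF (K : fieldExtType rat) p f : prime p -> (0 < f)%N ->
  (tau p f <= nb_primes K p f)%N -> frakP K p.
Proof.
move=> p_pr f_gt0; rewrite /tau; case: eqP => [->|/eqP f1] le; split=> //; first by right.
left; apply: common_index_divisorP => // theta; apply: contraLR le => pN.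
by rewrite -leqNgt (@nb_primes_le_irr _ theta) // ltn_neqAle eq_sym f1.
Qed.

Lemma finite_cover_primes (K : fieldExtType rat) (n : nat) : covered_by (ring_int K) n ->
  exists p f (k : finFieldType) (Q : 'I_(tau p f) -> prime_idealr (ring_int K)),
    [/\ prime p, (0 < f)%N, #|k| = (p ^ f)%N,
        (tau p f * (2 * #|max_subr k| + f * (tau p f).-1) <= 2 * n)%N
      & (forall i, prime_over p f (Q i)) /\ (forall i j, Q i =i Q j -> i = j)].
Proof.
move=> /cover_mod_prime[p p_pr [S [Y SY]]]; have [m [rep repP]] := int_quot_finite K p_pr.
have [t [P [pP P_inj P_all]]] := primes_above_enum repP.
have [f [k [f_gt0 ck le_tau bound]]] := prime_cover_bound p_pr pP P_inj P_all SY.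
exists p, f, k, (fun i => P (enum_val (widen_ord le_tau i))); split=> //; split.
  move=> i; split; first exact/lies_overP.
  by have := enum_valP (widen_ord le_tau i); rewrite inE => /asboolP.
by move=> i j /P_inj/enum_val_inj/(congr1 val) /= ij; exact: val_inj.
Qed.

Lemma tau_gt0 p f : prime p -> (0 < tau p f)%N.
Proof. by move=> p_pr; rewrite /tau; case: eqP => // _; exact: prime_gt0. Qed.

(** * The three formulas for the covering number *)

Unset Implicit Arguments.
Local Close Scope quotient_scope.

Theorem theorem29 (K : fieldExtType rat)
    (coverA : finitely_coverable (ring_int K)) :
  [/\ sigma (ring_int K) =
        covinf [set v | exists I : idealr (ring_int K),
                  faulty I /\ v = sigma {ideal_quot I}],
      forall P : forall p f : nat, 'I_(tau p f) -> prime_idealr (ring_int K),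
        (forall p f, p \in frakP K -> f \in frakF K p ->
           (forall i, prime_over p f (P p f i)) /\
           (forall i j, P p f i =i P p f j -> i = j)) ->
        sigma (ring_int K) =
          covinf [set covinf
                    [set sigma (prod_ring (fun i => {ideal_quot P p f i}))
                       | f in frakF K p]
                 | p in frakP K]
    & sigma (ring_int K) =
        covinf [set v | exists p (p_prime : prime p),
                  p \in frakP K /\ v = sigma {ideal_quot pA K p_prime}]].
Proof.
have [n sigmaA An] := sigma_finP coverA.
have [p [f [k [Q [p_pr f_gt0 ck bound [Qf Q_inj]]]]]] := finite_cover_primes An.
have pQ i : p%:R \in Q i by apply/(lies_overP p_pr); case: (Qf i).
have le_tau : (tau p f <= nb_primes K p f)%N := family_nb_primes p_pr Qf Q_inj.
have pP : frakP K p := frakP_frakF p_pr f_gt0 le_tau.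
have fF : frakF K p f.
  split; first by exists (Q (Ordinal (tau_gt0 f p_pr))).
  by move: le_tau; rewrite /tau; case: eqP => // ->.
(* The residue fields at the [Q i] are images of the quotient, and the cover pulled back from them
   has no more than n members. *)
have sigma_quot_le (I : idealr (ring_int K)) : (forall i, {subset I <= Q i}) ->
    (sigma {ideal_quot I} <= sigma (ring_int K))%O.
  move=> IQ; have [h h_onto] := quot_residues_onto p_pr pQ Q_inj IQ.
  have [m mn Rm] := covered_by_residues p_pr f_gt0 ck (card_ord _) bound Qf h_onto.
  by rewrite sigmaA; apply: le_trans (sigma_covered Rm) _.
split.
- have [I [IQ pI IdivQ]] := prime_intersection p_pr (Ordinal (tau_gt0 f p_pr)) pQ Q_inj.
  apply: covinf_eq => [|_ [J [_ ->]]]; last exact: sigma_quot coverA.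
  exists (sigma {ideal_quot I}); last exact: sigma_quot_le.
  exists I; split=> //; split.
    exists p%:R => //; have := int_eq0 K p; rewrite -pmulrn => ->.
    by rewrite eqz_nat -lt0n prime_gt0.
  exists p, f; split=> //; apply: (@ord_leq_setcard _ _ _ (fun i => [set` Q i])).
  + exact: finite_prime_divisors.
  + by move=> i; exists (Q i).
  + by move=> i j /seteqP[ij ji]; apply: Q_inj => x; apply/idP/idP; [exact: ij|exact: ji].
- move=> P PP; apply: covinf_eq => [|_ [q qP <-]]; last first.
    apply: le_covinf => _ [g gF <-].
    have [Pg Pg_inj] := PP q g (mem_set qP) (mem_set gF).
    have q_pr : prime q by case: qP.
    have pPg i : q%:R \in P q g i by apply/(lies_overP q_pr); case: (Pg i).
    have [h h_onto] := prod_residues_onto q_pr pPg Pg_inj.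
    exact: (sigma_onto coverA h_onto).
  exists (covinf [set sigma (prod_ring (fun i => {ideal_quot P p f i})) | f in frakF K p]).
    by exists p.
  (* The size of the explicit cover depends on p, f and k only, so the prescribed primes [P p f]
     serve as well as the [Q i]. *)
  have [Pf P_inj] := PP p f (mem_set pP) (mem_set fF).
  apply: (@le_trans _ _ (sigma (prod_ring (fun i => {ideal_quot P p f i})))).
    by apply: covinf_le; exists f.
  have [h hE] := fin_all_exists (fun i => @prod_ring_proj _ (fun i => {ideal_quot P p f i}) i).
  have h_onto (y : forall i, {ideal_quot P p f i}) :
      exists x : prod_ring (fun i => {ideal_quot P p f i}), forall i, h i x = y i.
    by exists y => i; rewrite hE.
  have [m mn Rm] := covered_by_residues p_pr f_gt0 ck (card_ord _) bound Pf h_onto.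
  by rewrite sigmaA; apply: le_trans (sigma_covered Rm) _.
- apply: covinf_eq => [|_ [q [q_pr [_ ->]]]]; last exact: sigma_quot coverA.
  exists (sigma {ideal_quot pA K p_pr}); last by apply: sigma_quot_le => i; exact: pA_sub.
  by exists p, p_pr; split=> //; exact: mem_set.
Qed.
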